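(* Let $(X,d)$ be a pointed proper metric space. The dimension of the sublinear Higson corona $\nu_L(X)$ of $X$ is the smallest integer $n\ge 0$ such that $\mathbb{R}^{n+1}$ is an absolute extensor of $X$ in the category $\tilde{\mathcal{A}}$.
   Context: For a pointed metric space with base point $x_0$, the norm of a point is $|x|=d(x,x_0)$; in $\mathbb{R}^k$ the base point is $0$. For points of a subset $A\subset X$, $|x|$ means the norm in $X$. A metric space is proper if its closed bounded subsets are compact. A function $f\colon (X,d_X)\to (Y,d_Y)$ is asymptotically Lipschitz if there are $\lambda, M\ge 0$ with $d_Y(f(x),f(y))\le \lambda\, d_X(x,y)+M$ for all $x,y\in X$ (no continuity required). The category $\tilde{\mathcal{A}}$ has pointed proper metric spaces as objects; its morphisms are the asymptotically Lipschitz functions $f\colon X\to Y$ for which there are constants $b,c>0$ with $|f(x)|\ge c\cdot|x|-b$ for all $x\in X$. $\mathbb{R}^{n+1}$ is an absolute extensor of $X$ in $\tilde{\mathcal{A}}$ if for every closed subset $A\subset X$, every morphism $A\to\mathbb{R}^{n+1}$ of $\tilde{\mathcal{A}}$ extends to a morphism $X\to\mathbb{R}^{n+1}$ of $\tilde{\mathcal{A}}$. Let $\mathbb{R}_+=[0,\infty)$. A continuous function $s\colon\mathbb{R}_+\to\mathbb{R}_+$ is asymptotically sublinear if for each non-constant linear function $f\colon\mathbb{R}_+\to\mathbb{R}_+$ there is $M$ such that $s(r)\le f(r)+M$ for all $r$. A continuous function $f\colon (X,d_X)\to (Y,d_Y)$ is Higson sublinear if for each asymptotically sublinear $s$, the conditions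 $x_n,y_n\to\infty$ (i.e. $|x_n|,|y_n|\to\infty$) and $d_X(x_n,y_n)\le s(|x_n|)$ for all $n\ge 1$ imply $d_Y(f(x_n),f(y_n))\to 0$. The Higson sublinear compactification $h_L(X)$ is the compactification of $X$ (compact Hausdorff, containing $X$ as a dense subspace) characterized by: a bounded continuous function $X\to\mathbb{R}$ extends continuously over $h_L(X)$ if and only if it is Higson sublinear. For $X$ proper, the sublinear Higson corona is $\nu_L(X)=h_L(X)\setminus X$. Dimension of a compact space means covering dimension. *)

(* Defs.v *)
From HB Require Import structures.
From mathcomp Require Import all_boot all_order all_algebra.
From mathcomp Require Import all_classical all_reals all_analysis.

Set Implicit Arguments.
Unset Strict Implicit.
Unset Printing Implicit Defensive.

Import Order.TTheory GRing.Theory Num.Theory.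
Import numFieldNormedType.Exports.

Local Open Scope classical_set_scope.
Local Open Scope ring_scope.

Definition is_least (P : nat -> Prop) (n : nat) : Prop :=
  P n /\ forall m : nat, P m -> (n <= m)%N.

Definition proper_metric (R : realType) (X : metricType R) : Prop :=
  forall A : set X, closed A ->
    (exists (x : X) (r : R), forall y, A y -> mdist x y <= r) -> compact A.

(* A function on a subset [A] of [X] is represented by a total function on [X]
   of which only the values on [A] matter.  Metrics are passed as plain distance
   functions, because the library's metric on ['rV[R]_k] is the sup one. *)
Definition asymp_lipschitz_on (R : realType) (X Y : Type)
    (dX : X -> X -> R) (dY : Y -> Y -> R) (A : set X) (f : X -> Y) : Prop :=
  exists lambda M : R, [/\ 0 <= lambda, 0 <= M &
    forall x y, A x -> A y -> dY (f x) (f y) <= lambda * dX x y + M].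

Definition asymp_morphism_on (R : realType) (X Y : Type)
    (dX : X -> X -> R) (x0 : X) (dY : Y -> Y -> R) (y0 : Y)
    (A : set X) (f : X -> Y) : Prop :=
  asymp_lipschitz_on dX dY A f /\
  exists b c : R, [/\ 0 < b, 0 < c &
    forall x, A x -> c * dX x x0 - b <= dY (f x) y0].

Definition euclidean_dist (R : realType) (k : nat) (u v : 'rV[R]_k) : R :=
  Num.sqrt (\sum_(i < k) (u ord0 i - v ord0 i) ^+ 2).

Definition euclidean_absolute_extensor (R : realType) (X : metricType R)
    (x0 : X) (k : nat) : Prop :=
  forall (A : set X) (f : X -> 'rV[R]_k), closed A ->
    asymp_morphism_on mdist x0 (@euclidean_dist R k) 0 A f ->
    exists g : X -> 'rV[R]_k,
      asymp_morphism_on mdist x0 (@euclidean_dist R k) 0 [set: X] g /\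
      forall x, A x -> g x = f x.

(* A non-constant linear function from [0, +oo[ to itself is
   [r |-> a * r + b] with [0 < a] and [0 <= b]. *)
Definition asymp_sublinear (R : realType) (s : R -> R) : Prop :=
  [/\ {within `[0, +oo[, continuous s},
      forall r, 0 <= r -> 0 <= s r &
      forall a b : R, 0 < a -> 0 <= b ->
        exists M : R, forall r, 0 <= r -> s r <= a * r + b + M].

Definition higson_sublinear (R : realType) (X : metricType R) (x0 : X)
    (f : X -> R) : Prop :=
  continuous f /\
  forall (s : R -> R) (x y : nat -> X), asymp_sublinear s ->
    mdist (x n) x0 @[n --> \oo] --> +oo ->
    mdist (y n) x0 @[n --> \oo] --> +oo ->
    (forall n, mdist (x n) (y n) <= s (mdist (x n) x0)) ->
    `|f (x n) - f (y n)| @[n --> \oo] --> (0 : R).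

Definition topological_embedding (X K : topologicalType) (i : X -> K) : Prop :=
  [/\ injective i, continuous i &
      forall U : set X, open U -> exists2 V : set K, open V & i @^-1` V = U].

Definition is_compactification (X K : topologicalType) (i : X -> K) : Prop :=
  [/\ compact [set: K], hausdorff_space K, topological_embedding i &
      dense (range i)].

(* [h_L(X)] is given by its characterization, which determines it up to a
   homeomorphism fixing [X]. *)
Definition is_higson_sublinear_compactification (R : realType)
    (X : metricType R) (x0 : X) (K : topologicalType) (i : X -> K) : Prop :=
  is_compactification i /\
  forall f : X -> R, continuous f -> bounded_fun f ->
    ((exists2 g : K -> R, continuous g & forall x, g (i x) = f x) <->
     higson_sublinear x0 f).

Definition corona (X K : topologicalType) (i : X -> K) : set K := ~` range i.

Definition finite_open_cover (T : topologicalType) (C : set (set T)) : Prop :=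
  [/\ finite_set C, forall U, C U -> open U &
      forall x, exists2 U, C U & U x].

Definition covering_dim_le (T : topologicalType) (n : nat) : Prop :=
  forall C : set (set T), finite_open_cover C ->
    exists D : set (set T),
      [/\ finite_open_cover D,
          forall V, D V -> exists2 U, C U & V `<=` U &
          forall x, ([set V | D V /\ V x] #<= `I_n.+1)%card].

(* The dimension is a natural number or infinite (when no [n] qualifies); in
   particular the empty space, the corona of a bounded [X], has dimension 0. *)
Definition has_covering_dim (T : topologicalType) (n : nat) : Prop :=
  is_least (covering_dim_le T) n.

(* Main.v *)
(** Normalising by [1 + |x|] turns Lipschitz functions on [X] into bounded Higson
sublinear functions, hence into continuous functions on the compactification;
conversely every Higson sublinear bounded function is approximated in this way,
by an infimal convolution with a multiple of the metric.  Coarse lower bounds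
[c |x| - b] on [X] correspond to positivity on the corona.

If the corona has dimension at most [n], a Lipschitz map [F] to [R^(n+1)] has,
after normalisation, a nowhere vanishing approximation on the corona: a partition
of unity of order [n+1] is combined with values in general position.  A Lipschitz
lift of the latter is clamped towards [F] where [F] is large.

Conversely, by an iteration over the [(n+2)]-element subfamilies it suffices to
shrink an [(n+2)]-element cover so that its intersection becomes empty.  Such a
cover is given by Lipschitz functions [G_0, .., G_(n+1) >= 0]; the differences
[G_j - G_(n+1)] are large where [min G] is small, so from there they extend to a
map [W] that is large everywhere, and [W - min W] (with [W_(n+1) = 0]) vanishes
in some coordinate at each point. *)

Require Import Defs.
From HB Require Import structures.
From mathcomp Require Import all_boot all_order all_algebra.
From mathcomp Require Import all_classical all_reals all_analysis.
From mathcomp Require Import ring lra.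

Set Implicit Arguments.
Unset Strict Implicit.
Unset Printing Implicit Defensive.

Import Order.TTheory GRing.Theory Num.Theory.
Import numFieldNormedType.Exports.

Local Open Scope classical_set_scope.
Local Open Scope ring_scope.

(** * Lipschitz real-valued functions and their closure properties *)

Section Lipschitz.
Context {R : realType} {X : metricType R}.
Implicit Types (F G : X -> R) (x y z : X).

(** The one-sided bound implies the one with absolute values by exchanging the points, and it suits
    linear arithmetic better. *)
Definition is_lipschitz F : Prop :=
  exists2 L : R, 0 <= L & forall x y, F x - F y <= L * mdist x y.

Lemma is_lipschitz_abs F L :
  (forall x y, F x - F y <= L * mdist x y) ->
  forall x y, `|F x - F y| <= L * mdist x y.
Proof.
move=> FL x y; rewrite ler_norml FL andbT.
by rewrite lerNl opprB metric_sym FL.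
Qed.

Lemma eq_is_lipschitz F G : F =1 G -> is_lipschitz F -> is_lipschitz G.
Proof. by move=> /funext ->. Qed.

Lemma is_lipschitz_cst (a : R) : is_lipschitz (fun=> a).
Proof. by exists 0 => // x y; rewrite subrr mul0r. Qed.

Lemma is_lipschitz_dist z : is_lipschitz (fun x => mdist x z).
Proof.
exists 1 => // x y; have := metric_triangle x y z; lra.
Qed.

Lemma is_lipschitzD F G :
  is_lipschitz F -> is_lipschitz G -> is_lipschitz (fun x => F x + G x).
Proof.
move=> [L L0 FL] [L' L0' GL]; exists (L + L') => [|x y]; first exact: addr_ge0.
have := FL x y; have := GL x y; lra.
Qed.

Lemma is_lipschitzN F : is_lipschitz F -> is_lipschitz (fun x => - F x).
Proof.
move=> [L L0 FL]; exists L => // x y.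
by rewrite opprK addrC metric_sym FL.
Qed.

Lemma is_lipschitzB F G :
  is_lipschitz F -> is_lipschitz G -> is_lipschitz (fun x => F x - G x).
Proof. by move=> FL /is_lipschitzN; exact: is_lipschitzD. Qed.

Lemma is_lipschitzZ (a : R) F : is_lipschitz F -> is_lipschitz (fun x => a * F x).
Proof.
move=> [L L0 /is_lipschitz_abs FL].
exists (`|a| * L) => [|x y]; first exact: mulr_ge0.
rewrite -mulrBr -mulrA (le_trans (ler_norm _))// normrM.
exact: ler_wpM2l.
Qed.

Lemma is_lipschitz_max F G : is_lipschitz F -> is_lipschitz G ->
  is_lipschitz (fun x => Num.max (F x) (G x)).
Proof.
move=> [L L0 FL] [L' L0' GL]; exists (L + L') => [|x y]; first exact: addr_ge0.
have d0 := mdist_ge0 x y.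
have h1 : 0 <= L * mdist x y by exact: mulr_ge0.
have h2 : 0 <= L' * mdist x y by exact: mulr_ge0.
have h3 : F y <= Num.max (F y) (G y) by rewrite le_max lexx.
have h4 : G y <= Num.max (F y) (G y) by rewrite le_max lexx orbT.
rewrite lerBlDr ge_max mulrDl; have := FL x y; have := GL x y.
by move=> *; apply/andP; split; lra.
Qed.

Lemma is_lipschitz_min F G : is_lipschitz F -> is_lipschitz G ->
  is_lipschitz (fun x => Num.min (F x) (G x)).
Proof.
move=> /is_lipschitzN FL /is_lipschitzN GL.
have := is_lipschitzN (is_lipschitz_max FL GL).
by congr is_lipschitz; apply/funext => x; rewrite -oppr_min opprK.
Qed.

Lemma is_lipschitz_norm F : is_lipschitz F -> is_lipschitz (fun x => `|F x|).
Proof.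
move=> [L L0 /is_lipschitz_abs FL]; exists L => // x y.
by apply: le_trans (FL x y); exact: lerB_dist.
Qed.

Lemma is_lipschitz_sum (I : finType) (P : pred I) (F : I -> X -> R) :
  (forall j, is_lipschitz (F j)) -> is_lipschitz (fun x => \sum_(j | P j) F j x).
Proof.
move=> FL; elim: (index_enum I) => [|j s IHs].
  by apply: (eq_is_lipschitz _ (is_lipschitz_cst 0)) => x; rewrite big_nil.
case Pj : (P j).
  by apply: (eq_is_lipschitz _ (is_lipschitzD (FL j) IHs)) => x; rewrite big_cons Pj.
by apply: (eq_is_lipschitz _ IHs) => x; rewrite big_cons Pj.
Qed.

Lemma is_lipschitz_bigmax (I : finType) (P : pred I) (F : I -> X -> R) :
  (forall j, is_lipschitz (F j)) ->
  is_lipschitz (fun x => \big[Num.max/0]_(j | P j) F j x).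
Proof.
move=> FL; elim: (index_enum I) => [|j s IHs].
  by apply: (eq_is_lipschitz _ (is_lipschitz_cst 0)) => x; rewrite big_nil.
case Pj : (P j).
  by apply: (eq_is_lipschitz _ (is_lipschitz_max (FL j) IHs)) => x; rewrite big_cons Pj.
by apply: (eq_is_lipschitz _ IHs) => x; rewrite big_cons Pj.
Qed.

Lemma is_lipschitz_continuous F : is_lipschitz F -> continuous F.
Proof.
move=> [L L0 /is_lipschitz_abs FL] x; apply/cvgrPdist_lt => e e0.
have d0 : 0 < e / (L + 1) by rewrite divr_gt0// ltr_wpDl.
near=> y.
have xy : mdist x y < e / (L + 1).
  near: y; have := nbhsx_ballx x _ d0.
  by rewrite ballEmdist.
rewrite (le_lt_trans (FL x y))//.
rewrite ltr_pdivlMr in xy; last by rewrite ltr_wpDl.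
have := mdist_ge0 x y; lra.
Unshelve. all: by end_near. Qed.

Lemma is_lipschitz_linear_growth (x0 : X) F : is_lipschitz F ->
  exists2 C : R, 0 < C & forall x, `|F x| <= C * (1 + mdist x x0).
Proof.
move=> [L L0 /is_lipschitz_abs FL]; exists (`|F x0| + L + 1) => [|x].
  by rewrite ltr_wpDl// addr_ge0.
have := FL x x0; have := mdist_ge0 x x0; have := normr_ge0 (F x0).
have := lerB_dist (F x) (F x0).
nra.
Qed.

End Lipschitz.

(** * McShane extension with an additive error *)

Section Mcshane.
Context {R : realType} {X : metricType R}.

(** McShane's formula, the infimum over [y] in [A] of [f y + L * mdist x y], is [L]-Lipschitz on all
    of [X]; the additive defect [M] only shows as the distance to [f] on [A]. *)
Lemma asymp_lipschitz_mcshane (A : set X) (f : X -> R) (L M : R) :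
  0 <= L -> 0 <= M ->
  (forall x y, A x -> A y -> f x - f y <= L * mdist x y + M) ->
  exists2 F : X -> R, is_lipschitz F & forall x, A x -> `|F x - f x| <= M.
Proof.
move=> L0 M0 fL; have [[a Aa]|A0] := pselect (exists a, A a); last first.
  by exists (fun=> 0) => [|x Ax]; [exact: is_lipschitz_cst|case: A0; exists x].
pose E x := [set f y + L * mdist x y | y in A].
have Ene x : E x !=set0 by exists (f a + L * mdist x a), a.
have Elb x : has_lbound (E x).
  exists (f a - L * mdist a x - M) => _ [y Ay <-].
  have := fL _ _ Aa Ay; have := ler_wpM2l L0 (metric_triangle a x y); lra.
have Einf x : has_inf (E x) by split.
exists (fun x => inf (E x)).
  exists L => // x y.
  rewrite lerBlDr -lerBlDl; apply: lb_le_inf => // _ [z Az <-].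
  have h : inf (E x) <= f z + L * mdist x z by apply: ge_inf => //; exists z.
  have := ler_wpM2l L0 (metric_triangle x y z); lra.
move=> x Ax; rewrite ler_norml; apply/andP; split; last first.
  suff : inf (E x) <= f x by lra.
  by apply: ge_inf => //; exists x => //; rewrite mdistxx; ring.
rewrite lerBrDl; apply: lb_le_inf => // _ [z Az <-].
have := fL _ _ Ax Az; lra.
Qed.

End Mcshane.

(** * Absolute extensors in terms of Lipschitz coordinates *)

Section Extensors.
Context {R : realType} {X : metricType R} (x0 : X).

(** For finitely many functions [|F j|] this is the coarse lower bound on the norm of the map with
    coordinates [F j], since the largest coordinate is comparable to the norm. *)
Definition grows_on (I : Type) (A : set X) (G : I -> X -> R) : Prop :=
  exists2 c : R, 0 < c &
    exists b : R, forall x, A x -> exists j, c * mdist x x0 - b <= G j x.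

(** The extension property up to bounded error: [F] is given on all of [X], which McShane's formula
    allows, but grows only on [A], and [W] has to grow everywhere while staying at bounded distance
    from [F] on [A]. *)
Definition lipschitz_extensor (m : nat) : Prop :=
  forall (A : set X) (F : 'I_m -> X -> R), closed A ->
    (forall j, is_lipschitz (F j)) -> grows_on A (fun j x => `|F j x|) ->
    exists (W : 'I_m -> X -> R) (M : R),
      [/\ forall j, is_lipschitz (W j),
          forall j x, A x -> `|W j x - F j x| <= M &
          grows_on [set: X] (fun j x => `|W j x|)].

Lemma coord_le_euclidean_dist m (u v : 'rV[R]_m) j :
  `|u ord0 j - v ord0 j| <= euclidean_dist u v.
Proof.
rewrite /euclidean_dist -sqrtr_sqr ler_wsqrtr// (bigD1 j)//= lerDl.
by apply: sumr_ge0 => k _; exact: sqr_ge0.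
Qed.

Lemma euclidean_dist_le_sum m (u v : 'rV[R]_m) :
  euclidean_dist u v <= \sum_(j < m) `|u ord0 j - v ord0 j|.
Proof.
rewrite /euclidean_dist -[leRHS]ger0_norm ?sumr_ge0// -sqrtr_sqr ler_wsqrtr//.
set a := \sum_(j < m) _; set b := \sum_(j < m) _.
suff [] : a <= b ^+ 2 /\ 0 <= b by [].
(* Nonnegativity of the sum is carried along because the cross term of the square must be
   nonnegative. *)
apply: (big_ind2 (fun a b => a <= b ^+ 2 /\ 0 <= b)) => [|c c' d d'|j _].
- by rewrite expr0n.
- by move=> [hc c0] [hd d0]; split; nra.
- by rewrite real_normK ?num_real.
Qed.

Lemma euclidean_dist_le_coord m (u : 'rV[R]_m.+1) :
  exists j, euclidean_dist u 0 <= m.+1%:R * `|u ord0 j|.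
Proof.
exists [arg max_(j > ord0) `|u ord0 j|]%O.
case: arg_maxP => //= j _ jmax.
apply: le_trans (euclidean_dist_le_sum _ _) _.
apply: (@le_trans _ _ (\sum_(k < m.+1) `|u ord0 j|)).
  by apply: ler_sum => k _; rewrite mxE subr0 jmax.
by rewrite sumr_const card_ord -[leLHS]mulr_natl.
Qed.

(** The extension supplied by the extensor property is only asymptotically Lipschitz, so McShane's
    formula replaces each of its coordinates by a Lipschitz function at distance at most [M]. *)
Lemma euclidean_extensor_lipschitz m :
  euclidean_absolute_extensor x0 m.+1 -> lipschitz_extensor m.+1.
Proof.
move=> AE A F cA FL [c c0 [b Fb]].
pose f x : 'rV[R]_m.+1 := \row_j F j x.
have [g [[[L [M [L0 M0 gL]]] [b' [c' [b0' c0' gb]]]] gf]] :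
    exists g, asymp_morphism_on mdist x0 (@euclidean_dist R m.+1) 0 [set: X] g /\
      forall x, A x -> g x = f x.
  apply: AE => //; split.
    have /choice[L FLj] : forall j, exists L, 0 <= L /\
        forall x y, F j x - F j y <= L * mdist x y.
      by move=> j; have [L] := FL j; exists L.
    exists (\sum_j L j), 0; split=> // [|x y _ _].
      by apply: sumr_ge0 => j _; have [] := FLj j.
    apply: le_trans (euclidean_dist_le_sum _ _) _.
    rewrite addr0 mulr_suml; apply: ler_sum => j _; rewrite !mxE.
    by apply: is_lipschitz_abs; have [] := FLj j.
  exists (`|b| + 1), c; split=> [|//|x Ax]; first by rewrite ltr_pwDr.
  have [j Fj] := Fb _ Ax.
  have := coord_le_euclidean_dist (f x) 0 j; rewrite !mxE subr0.
  have := ler_norm b; lra.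
have /choice[W WP] : forall j, exists w, is_lipschitz w /\
    forall x, `|w x - g x ord0 j| <= M.
  move=> j.
  have [x y|w wL wM] := @asymp_lipschitz_mcshane _ _ setT (fun x => g x ord0 j) _ _ L0 M0.
    move=> _ _; apply: le_trans (gL x y I I).
    by apply: le_trans (ler_norm _) _; exact: coord_le_euclidean_dist.
  by exists w; split=> // x; exact: wM.
exists W, M; split=> [j|j x Ax|]; first by have [] := WP j.
  by have := (WP j).2 x; rewrite gf// mxE.
exists (c' / m.+1%:R); first by rewrite divr_gt0.
exists (b' / m.+1%:R + M) => x _.
have [j gj] := euclidean_dist_le_coord (g x); exists j.
have gbx := gb x I.
have : (c' * mdist x x0 - b') / m.+1%:R <= `|g x ord0 j|.
  by rewrite ler_pdivrMr// (le_trans gbx)// mulrC.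
rewrite mulrBl mulrAC => h1; have h2 := (WP j).2 x.
rewrite distrC in h2; have h3 := lerB_dist (g x ord0 j) (W j x).
rewrite opprD addrA lerBlDr; apply: le_trans h1 _; lra.
Qed.

(** The coordinates of [f] are first replaced by Lipschitz functions at bounded distance; their
    extension [W] is then corrected to [f] itself on [A]. *)
Lemma lipschitz_extensor_euclidean m :
  lipschitz_extensor m.+1 -> euclidean_absolute_extensor x0 m.+1.
Proof.
move=> LE A f cA [[L [M [L0 M0 fL]]] [b [c [b0 c0 fb]]]].
have /choice[F FP] : forall j, exists w, is_lipschitz w /\
    forall x, A x -> `|w x - f x ord0 j| <= M.
  move=> j.
  have [x y Ax Ay|w wL wM] := @asymp_lipschitz_mcshane _ _ A (fun x => f x ord0 j) _ _ L0 M0.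
    apply: le_trans (fL x y Ax Ay).
    by apply: le_trans (ler_norm _) _; exact: coord_le_euclidean_dist.
  by exists w.
have [||W [M' [WL WF [c' c0' [b' Wb]]]]] := LE A F cA.
- by move=> j; have [] := FP j.
- exists (c / m.+1%:R); first by rewrite divr_gt0.
  exists (b / m.+1%:R + M) => x Ax.
  have [j fj] := euclidean_dist_le_coord (f x); exists j.
  have : (c * mdist x x0 - b) / m.+1%:R <= `|f x ord0 j|.
    by rewrite ler_pdivrMr// (le_trans (fb _ Ax))// mulrC.
  rewrite mulrBl mulrAC => h1; have h2 := (FP j).2 x Ax.
  rewrite distrC in h2.
  have h3 := lerB_dist (f x ord0 j) (F j x).
  rewrite opprD addrA lerBlDr; apply: le_trans h1 _; lra.
(* The jump between the two branches is bounded by [D] in each coordinate, which is harmless as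
   morphisms need not be continuous. *)
pose g x := if x \in A then f x else \row_j W j x.
have gA x : A x -> g x = f x by rewrite /g => /mem_set ->.
pose D := M + `|M'|.
have D0 : 0 <= D by exact: addr_ge0.
have gW j x : `|g x ord0 j - W j x| <= D.
  rewrite /g; case: ifPn => [/set_mem Ax|_]; last by rewrite mxE subrr normr0.
  have h1 := ler_norm M'.
  have h2 := (FP j).2 x Ax; have := WF j x Ax.
  have := ler_distD (F j x) (f x ord0 j) (W j x).
  rewrite distrC in h2; rewrite [`|W j x - _|]distrC /D; lra.
exists g; split=> //; split.
  have /choice[K KP] : forall j, exists K, 0 <= K /\
      forall x y, W j x - W j y <= K * mdist x y.
    by move=> j; have [K] := WL j; exists K.
  exists (\sum_j K j), (\sum_(j < m.+1) (D + D)); split=> [||x y _ _].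
  - by apply: sumr_ge0 => j _; have [] := KP j.
  - by apply: sumr_ge0 => j _; exact: addr_ge0.
  apply: le_trans (euclidean_dist_le_sum _ _) _.
  rewrite mulr_suml -big_split/=; apply: ler_sum => j _.
  have := is_lipschitz_abs (KP j).2 x y.
  have h1 := gW j x; have h2 := gW j y; rewrite distrC in h2.
  have h3 := ler_distD (W j x) (g x ord0 j) (g y ord0 j).
  have h4 := ler_distD (W j y) (W j x) (g y ord0 j).
  lra.
exists (`|b'| + D + 1), c'; split=> [|//|x _]; first by rewrite ltr_pwDr// addr_ge0.
have [j Wj] := Wb x I.
have := coord_le_euclidean_dist (g x) 0 j; rewrite mxE subr0.
have h1 := gW j x; rewrite distrC in h1.
have h2 := lerB_dist (W j x) (g x ord0 j).
have := ler_norm b'; lra.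
Qed.

End Extensors.

(** * Finite families of real functions *)

Section FiniteFamilies.
Context {R : realType} {X : topologicalType}.

Lemma closed_exists_le (I : finType) (G : I -> X -> R) (g : X -> R) :
  (forall j, continuous (G j)) -> continuous g ->
  closed [set x | exists j, G j x <= g x].
Proof.
move=> Gc gc.
rewrite (_ : [set x | _] = \big[setU/set0]_(j : I) [set x | G j x <= g x]).
  apply: closed_bigsetU => j _.
  rewrite (_ : [set x | _] = (fun x => g x - G j x) @^-1` [set r | 0 <= r]).
    apply: closed_comp; last exact: closed_ge.
    by move=> x _; apply: cvgB; [exact: gc|exact: Gc].
  by apply/seteqP; split=> x /=; rewrite subr_ge0.
rewrite -bigcup_seq; apply/seteqP; split=> x /= [j].
  by move=> h; exists j => //=; rewrite mem_index_enum.
by move=> _ h; exists j.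
Qed.

Lemma bigmax0_attained (I : finType) (F : I -> R) :
  \big[Num.max/0]_j F j = 0 \/ exists j, \big[Num.max/0]_j F j = F j.
Proof.
elim/big_rec : _ => [|j y _ IH]; first by left.
by rewrite maxEle; case: ifP => _ //; right; exists j.
Qed.

End FiniteFamilies.

(** * Shrinking Lipschitz families to bounded order *)

Section Shrinking.
Context {R : realType} {X : metricType R} (x0 : X).
Notation grows G := (grows_on x0 [set: X] G).

(** On [A], the function [Q i - min Q] differs from [G i - min G] by at most [2 * |M|], so
    subtracting that constant brings it below [G i]. Outside [A] every [G j] is large, so taking the
    minimum with [G] preserves growth. *)
Lemma shrink_extensor n (G : 'I_n.+2 -> X -> R) :
  lipschitz_extensor x0 n.+1 ->
  (forall j, is_lipschitz (G j)) -> (forall j x, 0 <= G j x) -> grows G ->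
  exists H : 'I_n.+2 -> X -> R,
    [/\ forall j, is_lipschitz (H j), forall j x, 0 <= H j x <= G j x,
        forall x, exists j, H j x = 0 & grows H].
Proof.
move=> LE GL G0 [s s0 [b Gb]].
pose F (j : 'I_n.+1) x := G (lift ord_max j) x - G ord_max x.
have FL j : is_lipschitz (F j) by exact: is_lipschitzB.
pose A := [set x | exists j, G j x <= s / 2 * mdist x x0].
have cA : closed A.
  apply: closed_exists_le => [j|]; apply: is_lipschitz_continuous => //.
  exact/is_lipschitzZ/is_lipschitz_dist.
have FA : grows_on x0 A (fun j x => `|F j x|).
  exists (s / 4); first lra.
  exists (b / 2) => x [i Gi]; have [k Gk] := Gb x I.
  (* At a point of [A] some [G i] is at most [s / 2 * |x|] and some [G k] is at least [s * |x| - b];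
     hence one of the two differs from [G ord_max] by at least half the gap. *)
  have Glast j : exists l, `|G j x - G ord_max x| <= `|F l x|.
    rewrite /F; case: (unliftP ord_max j) => [l ->|->]; first by exists l.
    by exists ord0; rewrite subrr normr0.
  have [li Fi] := Glast i; have [lk Fk] := Glast k.
  have h1 := ler_norm (- (G i x - G ord_max x)); rewrite normrN in h1.
  have h2 := ler_norm (G k x - G ord_max x).
  have [h|h] := leP (s / 4 * mdist x x0 - b / 2) `|F li x|; first by exists li.
  exists lk; lra.
have [W [M [WL WF [c c0 [b' Wb]]]]] := LE A F cA FL FA.
pose Q i x := if unlift ord_max i is Some j then W j x else 0.
have QL i : is_lipschitz (Q i).
  by rewrite /Q; case: unlift => [j|]; [exact: WL|exact: is_lipschitz_cst].
(* This is [- min Q]: the initial value 0 of the maximum is the contribution of the last coordinate,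
   where [Q] is 0. *)
pose m x := \big[Num.max/0]_j - W j x.
have mL : is_lipschitz m by apply: is_lipschitz_bigmax => j; exact: is_lipschitzN.
have m0 x : 0 <= m x by exact: bigmax_ge_id.
have mW x j : - W j x <= m x by exact: (le_bigmax_cond _ (fun j => - W j x)).
have mE x : exists i, m x = - Q i x.
  have [e|[j e]] := bigmax0_attained (fun j => - W j x).
    by exists ord_max; rewrite /m e /Q unlift_none oppr0.
  by exists (lift ord_max j); rewrite /m e /Q liftK.
pose P i x := Num.max (Q i x + m x - 2 * `|M|) 0.
have PL i : is_lipschitz (P i).
  apply: is_lipschitz_max; last exact: is_lipschitz_cst.
  apply: is_lipschitzB; last exact: is_lipschitz_cst.
  exact: is_lipschitzD.
have P0 i x : 0 <= P i x by rewrite le_max lexx orbT.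
have QG x i : A x -> `|Q i x - (G i x - G ord_max x)| <= `|M|.
  move=> Ax; rewrite /Q; case: unliftP => [j ->|->].
    exact: le_trans (WF j x Ax) (ler_norm _).
  by rewrite !subrr normr0.
have PG x i : A x -> P i x <= G i x.
  move=> Ax; rewrite ge_max G0 andbT; have [j ->] := mE x.
  have := QG x i Ax; have := QG x j Ax; rewrite !ler_norml.
  have := G0 j x; move=> ? /andP[? ?] /andP[? ?]; lra.
exists (fun i x => Num.min (P i x) (G i x)); split=> [j|j x|x|].
- exact: is_lipschitz_min.
- by rewrite le_min P0 G0 ge_min lexx orbT.
- have [i mi] := mE x; exists i.
  rewrite (_ : P i x = 0) ?min_l//.
  by rewrite /P mi subrr sub0r max_r// oppr_le0 mulr_ge0.
exists (Num.min c (s / 2)); first by rewrite lt_min c0/=; lra.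
exists (`|b'| + 2 * `|M|) => x _.
have d0 := mdist_ge0 x x0.
(* A large nonnegative [W j] makes [P] large at the index of [j]; a very negative one makes [m],
   hence [P ord_max], large. *)
have [i Pi] : exists i, c * mdist x x0 - `|b'| - 2 * `|M| <= P i x.
  have [j Wj] := Wb x I; have := ler_norm b'.
  have [W0|W0] := leP 0 (W j x).
    exists (lift ord_max j); rewrite le_max /Q liftK.
    have := m0 x; rewrite ger0_norm// in Wj.
    by move=> *; apply/orP; left; lra.
  exists ord_max; rewrite le_max /Q unlift_none.
  have := mW x j; rewrite ltr0_norm// in Wj.
  by move=> *; apply/orP; left; lra.
have minc : Num.min c (s / 2) * mdist x x0 <= c * mdist x x0.
  by rewrite ler_wpM2r// ge_min lexx.
have mins : Num.min c (s / 2) * mdist x x0 <= s / 2 * mdist x x0.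
  by rewrite ler_wpM2r// ge_min lexx orbT.
exists i; rewrite le_min; apply/andP; split; first by lra.
have [Ax|nAx] := pselect (A x); first by have := PG x i Ax; lra.
have Gi : s / 2 * mdist x x0 < G i x.
  by rewrite ltNge; apply/negP => h; apply: nAx; exists i.
have := normr_ge0 b'; have := normr_ge0 M; lra.
Qed.

(** The subfamily alone need not grow, so each member is enlarged by the maximum [T] of the others
    before shrinking. Wherever the enlargement is what makes the shrunk function large, some
    untouched member outside the subfamily is large as well. *)
Lemma shrink_subfamily n k (s : 'I_n.+2 -> 'I_k) (G : 'I_k -> X -> R) :
  lipschitz_extensor x0 n.+1 -> injective s ->
  (forall j, is_lipschitz (G j)) -> (forall j x, 0 <= G j x) -> grows G ->
  exists H : 'I_k -> X -> R,
    [/\ forall j, is_lipschitz (H j), forall j x, 0 <= H j x <= G j x,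
        forall x, exists i, H (s i) x = 0 & grows H].
Proof.
move=> LE sI GL G0 [c c0 [b Gb]].
pose T x := \big[Num.max/0]_(t | t \notin codom s) G t x.
have TL : is_lipschitz T by exact: is_lipschitz_bigmax.
pose G' i x := Num.max (G (s i) x) (T x).
have [|||H [HL HG Hz [c' c0' [b' Hb]]]] := @shrink_extensor n G' LE.
- by move=> j; exact: is_lipschitz_max.
- by move=> j x; rewrite le_max G0.
- exists c => //; exists b => x _; have [j Gj] := Gb x I.
  have [/codomP[i ji]|js] := boolP (j \in codom s).
    by exists i; rewrite le_max -ji Gj.
  exists ord0; rewrite le_max; apply/orP; right.
  by rewrite (le_trans Gj)//; exact: (le_bigmax_cond _ (fun j => G j x)).
pose P j := if [pick i | s i == j] is Some i then H i else G j.
have Ps i : P (s i) = H i.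
  rewrite /P; case: pickP => [i' /eqP/sI ->//|/(_ i)].
  by rewrite eqxx.
have Pn j : j \notin codom s -> P j = G j.
  rewrite /P; case: pickP => [i /eqP <-|//].
  by rewrite codom_f.
have H0 i x : 0 <= H i x by have /andP[] := HG i x.
exists (fun j x => Num.min (P j x) (G j x)); split=> [j|j x|x|].
- by apply: is_lipschitz_min => //; rewrite /P; case: pickP.
- rewrite le_min G0 ge_min lexx orbT !andbT.
  by rewrite /P; case: pickP.
- by have [i Hi] := Hz x; exists i; rewrite Ps Hi min_l.
exists (Num.min c c'); first by rewrite lt_min c0.
exists (Num.max `|b| `|b'|) => x _.
have [i Hi] := Hb x I.
have minc' : Num.min c c' * mdist x x0 <= c' * mdist x x0.
  by rewrite ler_wpM2r ?mdist_ge0// ge_min lexx orbT.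
have bb : b' <= Num.max `|b| `|b'| by rewrite le_max ler_norm orbT.
have h : Num.min c c' * mdist x x0 - Num.max `|b| `|b'| <= H i x by lra.
have /andP[_] := HG i x; rewrite le_max => /orP[HGi|HT].
  by exists (s i); rewrite Ps [leRHS]min_l.
have [T0|[j [js Tj]]] : T x = 0 \/ exists j, j \notin codom s /\ T x = G j x.
  rewrite /T; elim/big_rec : _ => [|j y js IH]; first by left.
  by rewrite maxEle; case: ifP => _ //; right; exists j.
- exists (s i); rewrite Ps [leRHS]min_l//.
  by apply: le_trans HT _; rewrite T0.
- by exists j; rewrite Pn// [leRHS]min_l// -Tj; exact: le_trans HT.
Qed.

(** Induction over a list of all index maps; zeros obtained for earlier subfamilies survive because
    the functions only decrease and stay nonnegative. *)
Lemma shrink_order n k (G : 'I_k -> X -> R) :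
  lipschitz_extensor x0 n.+1 ->
  (forall j, is_lipschitz (G j)) -> (forall j x, 0 <= G j x) -> grows G ->
  exists H : 'I_k -> X -> R,
    [/\ forall j, is_lipschitz (H j), forall j x, 0 <= H j x <= G j x, grows H &
        forall s : 'I_n.+2 -> 'I_k, injective s ->
          forall x, exists i, H (s i) x = 0].
Proof.
move=> LE GL G0 Gg.
suff [H [HL HG Hg Hs]] : exists H : 'I_k -> X -> R,
    [/\ forall j, is_lipschitz (H j), forall j x, 0 <= H j x <= G j x, grows H &
        forall s : {ffun 'I_n.+2 -> 'I_k}, s \in enum {: {ffun 'I_n.+2 -> 'I_k}} ->
          injective s -> forall x, exists i, H (s i) x = 0].
  exists H; split=> // s sI x.
  have [|i] := Hs (finfun s) (mem_enum _ _) _ x.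
    by move=> i j; rewrite !ffunE => /sI.
  by rewrite ffunE => Hi; exists i.
elim: (enum _) => [|s l [H [HL HG Hg Hs]]].
  by exists G; split=> // j x; rewrite G0 lexx.
have [sI|nsI] := pselect (injective s); last first.
  exists H; split=> // s'; rewrite inE => /orP[/eqP->//|]; exact: Hs.
have H0 j x : 0 <= H j x by have /andP[] := HG j x.
have [H' [HL' HG' Hz Hg']] := shrink_subfamily LE sI HL H0 Hg.
exists H'; split=> // [j x|s'].
  have /andP[-> HH] := HG' j x; have /andP[_] := HG j x; exact: le_trans.
rewrite inE => /orP[/eqP->//|sl] sI' x.
have [i Hi] := Hs _ sl sI' x; exists i.
by apply/eqP; rewrite eq_le; have /andP[-> ] := HG' (s' i) x; rewrite Hi => ->.
Qed.

End Shrinking.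

(** * Higson sublinear functions and Lipschitz approximation *)

Section HigsonSublinear.
Context {R : realType} {X : metricType R} (x0 : X).

(* A countable infimum of affine functions with positive slopes tending to [0]
   dominates the sequence [d] along [t] while being asymptotically sublinear. *)
Lemma asymp_sublinear_majorant (t d : nat -> R) :
  (forall n, 0 <= t n) -> (forall n, 0 <= d n) ->
  (forall n, d n <= t n / n.+1%:R) ->
  exists2 s : R -> R, asymp_sublinear s & forall n, d n <= s (t n).
Proof.
move=> t0 d0 dt.
pose C k := \sum_(0 <= n < k) d n.
have C0 k : 0 <= C k by apply: sumr_ge0.
have dC n k : (n < k)%N -> d n <= C k.
  move=> nk; rewrite /C (bigD1_seq n) ?mem_index_iota ?iota_uniq//= lerDl.
  by apply: sumr_ge0.
(* The constant [C k] bounds [d n] for [n < k], and the slope bounds it for [n >= k]. Truncating [r]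
   at 0 keeps the infimum bounded below on the whole line. *)
pose e r k := Num.max r 0 / k.+1%:R + C k.
pose E r := range (e r).
have e0 r k : 0 <= e r k.
  by rewrite addr_ge0// divr_ge0// le_max lexx orbT.
have Ene r : E r !=set0 by exists (e r 0%N), 0%N.
have Elb r : has_lbound (E r) by exists 0 => _ [k _ <-].
pose s r := inf (E r).
have sle r k : s r <= e r k by apply: ge_inf => //; exists k.
have sge r a : (forall k, a <= e r k) -> a <= s r.
  by move=> ae; apply: lb_le_inf => // _ [k _ <-].
(* All slopes are at most 1, so the infimum is 1-Lipschitz and therefore continuous. *)
have slip r r' : s r - s r' <= `|r - r'|.
  rewrite lerBlDr -lerBlDl; apply: sge => k.
  rewrite lerBlDl; apply: le_trans (sle r k) _.
  rewrite /e addrA lerD2r -lerBlDr -mulrBl.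
  rewrite ler_pdivrMr//; apply: (@le_trans _ _ `|r - r'|); last first.
    by rewrite ler_peMr// ler1n.
  rewrite lerBlDr ge_max; apply/andP; split.
    have := ler_norm (r - r'); have : r' <= Num.max r' 0 by rewrite le_max lexx.
    lra.
  by rewrite addr_ge0// le_max lexx orbT.
exists s.
  split.
  - apply: continuous_subspaceT => r; apply/cvgrPdist_lt => a a0; near=> r'.
    have rr' : `|r - r'| < a by near: r'; exact: (nbhsx_ballx r a a0).
    apply: le_lt_trans rr'; rewrite ler_norml slip andbT.
    by rewrite lerNl opprB distrC slip.
  - by move=> r _; apply: sge.
  - move=> a b a0 b0.
    have [k ka] : exists k, k.+1%:R^-1 <= a.
      exists (Num.bound a^-1).
      rewrite -[leRHS]invrK lef_pV2 ?posrE ?invr_gt0//.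
      rewrite (le_trans (ltW (archi_boundP _)))// ?ler_nat// ltW// invr_gt0//.
    exists (C k) => r r0; apply: le_trans (sle r k) _.
    rewrite /e max_l// lerD2r -[leLHS]addr0 lerD// mulrC ler_wpM2r//.
move=> n; apply: sge => k; rewrite /e max_l//.
have [nk|kn] := ltnP n k; first by rewrite (le_trans (dC _ _ nk))// lerDr divr_ge0.
apply: le_trans (dt n) _; rewrite -[leLHS]addr0 lerD// ler_wpM2l//.
by rewrite lef_pV2 ?posrE// ler_nat.
Unshelve. all: by end_near. Qed.

(** If no such [delta] and [r] existed, there would be bad pairs at distance at most
    [|x_n| / (n + 1)] going to infinity; a single asymptotically sublinear function dominates all
    these distances, contradicting the hypothesis on [f]. *)
Lemma higson_sublinear_modulus (f : X -> R) (e : R) :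
  higson_sublinear x0 f -> 0 < e ->
  exists delta r : R, [/\ 0 < delta, 0 <= r &
    forall x y, r <= mdist x x0 -> r <= mdist y x0 ->
      mdist x y <= delta * mdist x x0 -> `|f x - f y| <= e].
Proof.
move=> [_ fs] e0; apply: contrapT => nmod.
have /choice[p pP] : forall n : nat, exists p : X * X,
    [/\ n%:R <= mdist p.1 x0, n%:R <= mdist p.2 x0,
        mdist p.1 p.2 <= mdist p.1 x0 / n.+1%:R & e < `|f p.1 - f p.2|].
  move=> n; apply: contrapT => np; apply: nmod.
  exists n.+1%:R^-1, n%:R; split=> // x y xn yn xy.
  rewrite leNgt; apply/negP => exy; apply: np; exists (x, y); split=> //.
  by rewrite mulrC.
have cvg_far (g : nat -> X) : (forall n, n%:R <= mdist (g n) x0) ->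
    mdist (g n) x0 @[n --> \oo] --> +oo.
  move=> gn; apply/cvgryPge => A; near=> n.
  apply: le_trans (gn n); apply: le_trans (ler_norm A) _.
  by near: n; exact: nbhs_infty_ger.
have [s ss sd] := @asymp_sublinear_majorant
  (fun n => mdist (p n).1 x0) (fun n => mdist (p n).1 (p n).2)
  (fun n => mdist_ge0 _ _) (fun n => mdist_ge0 _ _)
  (fun n => let: And4 _ _ h _ := pP n in h).
have := fs s (fun n => (p n).1) (fun n => (p n).2) ss.
move=> /(_ (cvg_far _ _) (cvg_far _ _) sd) fp.
have {fp} : (`|f (p n).1 - f (p n).2|) @[n --> \oo] --> (0 : R).
  by apply: fp => n; have [] := pP n.
move=> /cvgrPdist_lt /(_ e e0) [N _ /(_ N (leqnn N))] /=.
by rewrite sub0r normrN normr_id ltNge => /negP; apply; have [_ _ _ /ltW] := pP N.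
Unshelve. all: by end_near. Qed.

Lemma is_lipschitz_quotient (F : X -> R) : is_lipschitz F ->
  let u x := F x / (1 + mdist x x0) in
  [/\ continuous u, exists B, forall x, `|u x| <= B & higson_sublinear x0 u].
Proof.
move=> FL u.
have N0 x : 0 < 1 + mdist x x0 by rewrite ltr_pwDl// mdist_ge0.
have uc : continuous u.
  move=> x; apply: cvgM; first exact: is_lipschitz_continuous.
  apply: cvgV; first by rewrite gt_eqF.
  apply: is_lipschitz_continuous; apply: is_lipschitzD.
    exact: is_lipschitz_cst.
  exact: is_lipschitz_dist.
have [C C0 FC] := is_lipschitz_linear_growth x0 FL.
split=> //.
  exists C => x; rewrite normrM normfV [`|1 + _|]gtr0_norm//.
  by rewrite ler_pdivrMr.
split=> // s x y [_ _ ss] xoo yoo xys.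
have [L L0 /is_lipschitz_abs FLx] := FL.
have uxy a b : `|u a - u b| <= (L + C) * mdist a b / (1 + mdist a x0).
  have -> : u a - u b = (F a - F b + F b / (1 + mdist b x0) * (mdist b x0 - mdist a x0))
                        / (1 + mdist a x0).
    by rewrite /u; field; rewrite !gt_eqF.
  rewrite normrM normfV [`|1 + _|]gtr0_norm// ler_pM2r ?invr_gt0//.
  rewrite mulrDl (le_trans (ler_normD _ _))// lerD//.
  rewrite !normrM normfV [`|1 + _|]gtr0_norm//.
  apply: ler_pM => //; first by rewrite divr_ge0// ltW.
    by rewrite ler_pdivrMr.
  rewrite distrC ler_norml; have := metric_triangle a b x0.
  have := metric_triangle b a x0; rewrite (metric_sym b a).
  by move=> *; apply/andP; split; lra.
have K0 : 0 < L + C by rewrite ltr_wpDl.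
apply/cvgrPdist_le => e e0.
(* This slope uses up half of [e]; the other half absorbs the constant [M] once [|x n|] is large. *)
have a0 : 0 < e / (2 * (L + C)) by rewrite divr_gt0// mulr_gt0.
have [M sM] := ss _ 0 a0 (lexx 0).
near=> n.
rewrite sub0r normrN normr_id; apply: le_trans (uxy _ _) _.
rewrite ler_pdivrMr//.
have t0 := mdist_ge0 (x n) x0.
have tn : 2 * (L + C) * `|M| / e <= mdist (x n) x0.
  by near: n; move/cvgryPge : xoo; exact.
have h1 : (L + C) * mdist (x n) (y n) <=
    (L + C) * (e / (2 * (L + C)) * mdist (x n) x0 + `|M|).
  rewrite ler_wpM2l ?(ltW K0)//; apply: le_trans (xys n) _; apply: le_trans (sM _ t0) _.
  by rewrite addr0 lerD2l ler_norm.
apply: le_trans h1 _.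
rewrite ler_pdivrMr// in tn.
have -> : (L + C) * (e / (2 * (L + C)) * mdist (x n) x0 + `|M|) =
   e * mdist (x n) x0 / 2 + (L + C) * `|M|.
  by field; rewrite gt_eqF.
lra.
Unshelve. all: by end_near. Qed.

(** [W] is the infimal convolution of [v * (1 + |.|)] with [L * mdist]. The slope [L] is so steep
    that points [y] beyond [d * |x|] do not matter, and at nearer points [v y] is close to [v x] by
    the modulus. *)
Lemma lipschitz_approximation (v : X -> R) (B e : R) :
  (forall x, `|v x| <= B) -> higson_sublinear x0 v -> 0 < e ->
  exists2 W : X -> R, is_lipschitz W &
    exists C, forall x, `|W x - v x * (1 + mdist x x0)| <= e * mdist x x0 + C.
Proof.
move=> vB vs e0.
have B0 : 0 <= B by exact: le_trans (vB x0).
have [|d' [r [d0' r0 dr]]] := @higson_sublinear_modulus v (e / 4) vs; first lra.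
(* With [d <= 1 / 2], a point within [d * |x|] of [x] still has norm at least [r] as soon as
   [|x| >= 2 * r]. *)
pose d := Num.min d' (1 / 2).
have d0 : 0 < d by rewrite lt_min d0'; lra.
have dd' : d <= d' by rewrite ge_min lexx.
have dh : d <= 1 / 2 by rewrite ge_min lexx orbT.
(* The summand [B] pays for the variation of the norm between [x] and [y]; the other one contributes
   at least [2 * B * |x|] when [mdist x y > d * |x|]. *)
pose L := B + 2 * B / d.
have LB : B <= L by rewrite lerDl divr_ge0 ?mulr_ge0// ltW.
have L0 : 0 <= L by exact: le_trans LB.
pose N x := 1 + mdist x x0.
have N1 x : 1 <= N x by rewrite lerDl mdist_ge0.
have vl x : - B <= v x /\ v x <= B by apply/andP; rewrite -ler_norml.
pose E x := range (fun y => v y * N y + L * mdist x y).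
have Elow x y : - (B * N x) <= v y * N y + L * mdist x y.
  have := metric_triangle y x x0; have [vy _] := vl y; have := N1 y.
  have := mdist_ge0 x y; rewrite (metric_sym y x) /N; nra.
have Ene x : E x !=set0 by exists (v x * N x + L * mdist x x), x.
have Elb x : has_lbound (E x) by exists (- (B * N x)) => _ [y _ <-].
pose W x := inf (E x).
have WE x y : W x <= v y * N y + L * mdist x y by apply: ge_inf => //; exists y.
exists W.
  exists L => // x y.
  rewrite lerBlDr -lerBlDl; apply: lb_le_inf => // _ [z _ <-].
  have := WE x z; have := ler_wpM2l L0 (metric_triangle x y z); lra.
exists (2 * B * (1 + 2 * r) + e / 4) => x.
have C0 : 0 <= 2 * B * (1 + 2 * r) by rewrite !mulr_ge0// addr_ge0// mulr_ge0.
have x0' := mdist_ge0 x x0.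
have ex : 0 <= e * mdist x x0 by rewrite mulr_ge0// ltW.
rewrite ler_norml -/(N x); apply/andP; split; last first.
  by have := WE x x; rewrite mdistxx mulr0; lra.
suff : v x * N x - (e * mdist x x0 + (2 * B * (1 + 2 * r) + e / 4)) <= W x by lra.
apply: lb_le_inf => // _ [y _ <-].
have [vx1 vx2] := vl x; have [vy1 vy2] := vl y.
have xy0 := mdist_ge0 x y.
have txy := metric_triangle x y x0.
have tyx := metric_triangle y x x0; rewrite (metric_sym y x) in tyx.
have y0' := mdist_ge0 y x0.
have [xr|xr] := ltP (mdist x x0) (2 * r).
  apply: le_trans (Elow x y); rewrite /N.
  have : v x * (1 + mdist x x0) <= B * (1 + mdist x x0).
    by rewrite ler_wpM2r// addr_ge0.
  have : B * (1 + mdist x x0) <= B * (1 + 2 * r) by rewrite ler_wpM2l// lerD2l ltW.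
  lra.
have BBr : 0 <= B * r by rewrite mulr_ge0.
have [xyd|xyd] := leP (mdist x y) (d * mdist x x0); last first.
  have h1 : 2 * B * mdist x x0 <= (L - B) * mdist x y.
    rewrite /L (addrC B) addrK [leRHS]mulrAC ler_pdivlMr// -[leLHS]mulrA ler_wpM2l ?mulr_ge0//.
    by rewrite mulrC ltW.
  have h2 : v x * (1 + mdist x x0) <= B * (1 + mdist x x0).
    by rewrite ler_wpM2r// addr_ge0.
  have h3 : - B * (1 + mdist y x0) <= v y * (1 + mdist y x0).
    by rewrite ler_wpM2r// addr_ge0.
  have h4 : B * mdist y x0 <= B * (mdist x y + mdist x x0) by rewrite ler_wpM2l.
  rewrite /N; lra.
have dxx : d * mdist x x0 <= 1 / 2 * mdist x x0 by rewrite ler_wpM2r.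
have vxy : `|v x - v y| <= e / 4.
  apply: dr; [lra|lra|apply: le_trans xyd _; exact: ler_wpM2r].
have {vxy} vxy : v x - v y <= e / 4 by apply: le_trans vxy; exact: ler_norm.
have h1 : (v x - v y) * (1 + mdist y x0) <= e / 4 * (1 + mdist y x0).
  by rewrite ler_wpM2r// addr_ge0.
have h2 : v x * (mdist x x0 - mdist y x0) <= B * mdist x y.
  rewrite (le_trans (ler_norm _))// normrM ler_pM// ler_norml.
  by apply/andP; split; lra.
have h3 : e * mdist y x0 <= e * (3 / 2 * mdist x x0) by rewrite ler_wpM2l ?(ltW e0)//; lra.
have h4 : B * mdist x y <= L * mdist x y by rewrite ler_wpM2r.
rewrite /N; lra.
Qed.

End HigsonSublinear.

(** * Finite sums and finite subcovers *)

Lemma continuous_sumr (R : realType) (T : topologicalType) (I : Type)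
    (s : seq I) (P : pred I) (g : I -> T -> R) :
  (forall l, continuous (g l)) -> continuous (fun z => \sum_(l <- s | P l) g l z).
Proof. by move=> gc; apply: continuous_big => //; exact: add_continuous. Qed.

(** The near-covering form of compactness is applied to the filter of finite lists of points of [A],
    directed by inclusion. *)
Lemma compact_finite_subcover (T : topologicalType) (A : set T) (f : T -> set T) :
  compact A -> (forall y, A y -> nbhs y (f y)) ->
  exists2 s : seq T, {subset s <= A} &
    forall z, A z -> exists2 y, y \in s & f y z.
Proof.
move=> /compact_near_coveringP Ac Af.
pose F := filter_from [set s : seq T | {subset s <= A}]
  (fun s => [set s' : seq T | {subset s <= s'} /\ {subset s' <= A}]).
have FF : Filter F.
  apply: filter_from_filter; first by exists [::].
  move=> s1 s2 s1A s2A; exists (s1 ++ s2).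
    by move=> x; rewrite mem_cat => /orP[/s1A|/s2A].
  move=> s [ss sA]; split; split=> // x xs; apply: ss;
  by rewrite mem_cat xs ?orbT.
have [|s sA sP] := Ac _ F (fun s z => exists2 y, y \in s & f y z) FF.
  move=> y Ay; exists (f y, [set s : seq T | y \in s]) => /=.
    split; first exact: Af.
    exists [:: y] => [x|s [ys _]]; first by rewrite inE => /eqP ->; exact/mem_set.
    by apply: ys; rewrite inE.
  by move=> [z s] /= [fz ys]; exists y.
by exists s => // z Az; exact: (sP s (conj _ sA)).
Qed.

(** * The corona of a compactification of a proper space *)

Section Compactification.
Context {R : realType} {X : metricType R} (x0 : X).
Context {K : topologicalType} (i : X -> K).
Context (Xproper : proper_metric X) (icomp : is_compactification i).

Let Kc : compact [set: K]. Proof. by case: icomp. Qed.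
Let Kh : hausdorff_space K. Proof. by case: icomp. Qed.
Let ic : continuous i. Proof. by case: icomp => _ _ []. Qed.
Let iopen (U : set X) : open U -> exists2 V, open V & i @^-1` V = U.
Proof. by case: icomp => _ _ [_ _ h] _; exact: h. Qed.
Let idense : dense (range i). Proof. by case: icomp. Qed.

(** Properness makes the ball compact, hence its image is closed in the Hausdorff space [K]. *)
Lemma closed_image_ball (r : R) : closed (i @` [set x | mdist x x0 <= r]).
Proof.
apply: compact_closed => //; apply: continuous_compact.
  exact: continuous_subspaceT.
apply: Xproper; last by exists x0, r => y /=; rewrite metric_sym.
rewrite (_ : [set x | _] = (fun x => mdist x x0) @^-1` [set a | a <= r])//.
apply: closed_comp; last exact: closed_le.
by move=> x _; exact/is_lipschitz_continuous/is_lipschitz_dist.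
Qed.

Lemma nbhs_corona_far (y : K) (r : R) : corona i y ->
  \forall z \near y, ~ (i @` [set x | mdist x x0 <= r]) z.
Proof.
move=> yi; apply: open_nbhs_nbhs; split; first exact/closed_openC/closed_image_ball.
by move=> [x _ xy]; apply: yi; exists x.
Qed.

(** An open [V] whose trace on [X] is an open ball lies in the image of the closed ball: otherwise
    density would yield a point of [X] in [V] outside that closed image. *)
Lemma nbhs_range (x : X) : nbhs (i x) (range i).
Proof.
pose r := mdist x x0 + 1.
have oU : open [set y | mdist y x0 < r].
  rewrite (_ : [set y | _] = (fun y => mdist y x0) @^-1` [set a | a < r])//.
  apply: open_comp; last exact: open_lt.
  by move=> y _; exact/is_lipschitz_continuous/is_lipschitz_dist.
have [V oV VU] := iopen oU.
have Vx : V (i x) by rewrite -[V _]/((i @^-1` V) x) VU /= ltrDl.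
apply: filterS (open_nbhs_nbhs (conj oV Vx)) => z Vz.
have [[y _ <-]|nz] := pselect ((i @` [set x | mdist x x0 <= r]) z); first by exists y.
have [|w [[Vw nw] [y _ yw]]] := idense _ (openI oV (closed_openC (@closed_image_ball r))).
  by exists z.
case: nw; exists y => //=; apply/ltW.
have : (i @^-1` V) y by rewrite /= yw.
by rewrite VU.
Qed.

Lemma corona_closed : closed (corona i).
Proof.
apply: open_closedC; rewrite openE => _ [x _ <-]; exact: nbhs_range.
Qed.

Lemma corona_compact : compact (corona i).
Proof. exact: (subclosed_compact corona_closed Kc). Qed.

Lemma near_corona_far (y : K) (P : K -> Prop) (r : R) : corona i y ->
  (\forall z \near y, P z) -> exists2 x, r < mdist x x0 & P (i x).
Proof.
move=> yi Py.
have : nbhs y (P `&` ~` (i @` [set x | mdist x x0 <= r])).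
  exact: (filterI Py (nbhs_corona_far r yi)).
rewrite nbhsE => -[U [oU Uy] UP].
have [|z [Uz [x _ xz]]] := idense _ oU; first by exists y.
have [Pz nz] := UP _ Uz; exists x; last by rewrite xz.
by rewrite ltNge; apply/negP => xr; apply: nz; exists x.
Qed.

(** Otherwise points of [X] violating [P] and going to infinity would cluster in [K]. A cluster
    point in [range i] has a neighbourhood with bounded trace on [X], and one in the corona has a
    neighbourhood where [P] holds. *)
Lemma far_near_corona (P : K -> Prop) :
  (forall y, corona i y -> \forall z \near y, P z) ->
  exists r : R, forall x, r <= mdist x x0 -> P (i x).
Proof.
move=> nP; apply: contrapT => nr.
pose F := filter_from [set: R] (fun r => i @` [set x | r <= mdist x x0 /\ ~ P (i x)]).
have FF : ProperFilter F.
  apply: filter_from_proper.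
    apply: filter_from_filter; first by exists 0.
    move=> r s _ _; exists (Num.max r s) => // _ [x [rsx nPx] <-].
    by move: rsx; rewrite ge_max => /andP[rx sx]; split; exists x.
  move=> r _; apply: contrapT => ne; apply: nr; exists r => x rx.
  by apply: contrapT => nPx; apply: ne; exists (i x), x.
have [z [_ zF]] := Kc FF filterT.
have [zi|/contrapT[x _ xz]] := pselect (corona i z).
  have [|w [[x [_ nPx] <-] Pw]] := zF (i @` [set x | 0 <= mdist x x0 /\ ~ P (i x)]) P _ (nP z zi).
    by exists 0.
  exact: nPx.
have oU : open [set y | mdist y x0 < mdist x x0 + 1].
  rewrite (_ : [set y | _] = (fun y => mdist y x0) @^-1` [set a | a < mdist x x0 + 1])//.
  apply: open_comp; last exact: open_lt.
  by move=> y _; exact/is_lipschitz_continuous/is_lipschitz_dist.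
have [V oV VU] := iopen oU.
have Vx : V z by rewrite -xz -[V _]/((i @^-1` V) x) VU /= ltrDl.
have [|w [[y [yx _] <-] Vy]] := zF (i @` [set y | mdist x x0 + 1 <= mdist y x0 /\ ~ P (i y)]) V _
    (open_nbhs_nbhs (conj oV Vx)).
  by exists (mdist x x0 + 1).
have : [set y | mdist y x0 < mdist x x0 + 1] y by rewrite -VU.
by rewrite /= ltNge yx.
Qed.

Lemma corona_ge0 (f : K -> R) (r : R) : continuous f ->
  (forall x, r <= mdist x x0 -> 0 <= f (i x)) ->
  forall y, corona i y -> 0 <= f y.
Proof.
move=> fc fr y yi; rewrite leNgt; apply/negP => fy0.
have [x rx] := near_corona_far r yi (cvgr_lt (f y) (fc y) 0 fy0).
by rewrite ltNge fr// ltW.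
Qed.

(** The near-covering property of the corona gives a uniform [eta], even if the corona is empty, and
    continuity carries the bound to far points of [X]. *)
Lemma far_pos_bound (f : K -> R) : continuous f ->
  (forall y, corona i y -> 0 < f y) ->
  exists2 eta : R, 0 < eta &
    exists r : R, forall x, r <= mdist x x0 -> eta <= f (i x).
Proof.
move=> fc f0.
have nc : near_covering (corona i) by apply/compact_near_coveringP; exact: corona_compact.
have := nc R (0 : R)^'+ (fun eta y => eta < f y) _.
have /[swap]/[apply] : forall x, corona i x -> \forall x' \near x & eta \near (0 : R)^'+, eta < f x'.
  move=> y yi; have fy := f0 y yi.
  exists ([set z | f y / 2 < f z], [set eta | eta < f y / 2]) => /=.
    split; last by apply: nbhs_right_lt; lra.
    by apply: (cvgr_gt (f y) (fc y)); lra.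
  by move=> [z eta] /= [h1 h2]; exact: lt_trans h1.
move=> nf.
have [eta [eta0 etaf]] : exists eta : R, 0 < eta /\ forall y, corona i y -> eta < f y.
  near (0 : R)^'+ => eta; exists eta; split => //.
  by near: eta; exact: nf.
exists eta => //; apply: (@far_near_corona (fun z => eta <= f z)) => y yi.
by apply: (cvgr_ge (f y) (fc y)); exact: etaf.
Unshelve. all: by end_near. Qed.

(** Finitely many Urysohn functions at corona points are grouped by the sets [O j] they are
    subordinate to. One function may enter several groups, which the normalisation tolerates. *)
Lemma partition_of_unity k (O : 'I_k -> set K) :
  (forall j, open (O j)) -> (forall y, corona i y -> exists j, O j y) ->
  exists phi : 'I_k -> K -> R,
    [/\ forall j, continuous (phi j), forall j z, 0 <= phi j z,
        forall j z, 0 < phi j z -> O j z &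
        forall y, corona i y -> \sum_j phi j y = 1].
Proof.
move=> Oo Oc.
have Kn : normal_space K := compact_normal Kh Kc.
have /choice[f fP] : forall y, exists f : K -> R,
    [/\ continuous f, forall z, 0 <= f z &
      corona i y -> f y = 1 /\ exists j, forall z, 0 < f z -> O j z].
  move=> y; have [yi|nyi] := pselect (corona i y); last first.
    by exists (fun=> 0); split=> // z; exact: cvg_cst.
  have [j Oy] := Oc _ yi.
  have cy : closed [set y] by exact/accessible_closed_set1/hausdorff_accessible.
  have [|f [fc f0 f1 f01]] := @urysohn_ext_itv K R Kn _ _ 0 1
      (open_closedC (Oo j)) cy _ ltr01.
    by apply/seteqP; split=> // z [/= nz zy]; apply: nz; rewrite zy.
  have fge z : 0 <= f z.
    by have := f01 (f z) (ex_intro2 _ _ z I erefl); rewrite /= in_itv/= => /andP[].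
  exists f; split=> // _; split; first by apply: f1; exists y.
  exists j => z fz; apply: contrapT => nz.
  by have := f0 (f z) (ex_intro2 _ _ z nz erefl) => /= fz0; rewrite fz0 ltxx in fz.
have fc y : continuous (f y) by have [] := fP y.
have f0 y z : 0 <= f y z by have [] := fP y.
have [|D Ds Dc] :=
    @compact_finite_subcover K (corona i) (fun y => [set z | 1 / 2 < f y z]) corona_compact.
  move=> y yi; have [_ _ /(_ yi)[fy _]] := fP y.
  by apply: (cvgr_gt (f y y) (fc y y)); rewrite fy; lra.
pose Phi (j : 'I_k) z :=
  \sum_(y <- D | `[< forall z, 0 < f y z -> O j z >]) f y z.
have Phi0 j z : 0 <= Phi j z by exact: sumr_ge0.
have Phic j : continuous (Phi j) by exact: continuous_sumr.
(* The truncation makes the quotient continuous on all of [K]; on the corona the sum exceeds 1/2, so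
   the quotients add up to 1 there. *)
pose S z := Num.max (\sum_j Phi j z) (1 / 2).
have S0 z : 0 < S z by rewrite lt_max; apply/orP; right; lra.
have Sc : continuous S.
  move=> z; apply: (@continuous_max _ _ (fun z => \sum_j Phi j z) (fun=> 1 / 2) z).
    exact: continuous_sumr.
  exact: cvg_cst.
exists (fun j z => Phi j z / S z); split=> [j z|j z|j z|y yi].
- apply: cvgM; first exact: Phic.
  by apply: cvgV; [rewrite gt_eqF|exact: Sc].
- by rewrite divr_ge0// ltW.
- rewrite pmulr_lgt0 ?invr_gt0// => Phij.
  apply: contrapT => nO; move: Phij; rewrite /Phi big1 ?ltxx// => y /asboolP yO.
  by apply/eqP; rewrite eq_le f0 andbT leNgt; apply/negP => /yO.
have Sy : 1 / 2 < \sum_j Phi j y.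
  have [y' y'D fy'] := Dc y yi.
  have /set_mem y'i := Ds y' y'D; have [_ _ /(_ y'i)[_ [j jO]]] := fP y'.
  apply: lt_le_trans fy' _; apply: (@le_trans _ _ (Phi j y)).
    by rewrite /Phi (big_rem y')//= asboolT// lerDl sumr_ge0.
  by rewrite (bigD1 j)//= lerDl sumr_ge0.
rewrite -mulr_suml /S max_l ?ltW// divff// gt_eqF// (lt_trans _ Sy)//; lra.
Qed.

End Compactification.

(** * Covering dimension of a subspace via indexed families *)

Section CoveringDimension.
Context {T : topologicalType}.

(** The open sets live in the ambient space while covering, refinement and order are required on [A]
    only. The order counts indices, so a repeated set counts repeatedly. *)
Definition indexed_dim_le (A : set T) (n : nat) : Prop :=
  forall k (O : 'I_k -> set T), (forall j, open (O j)) ->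
    (forall y, A y -> exists j, O j y) ->
    exists k' (Q : 'I_k' -> set T),
      [/\ forall j, open (Q j), forall y, A y -> exists j, Q j y,
          forall j, exists l, forall y, A y -> Q j y -> O l y &
          forall s : 'I_n.+2 -> 'I_k', injective s ->
            forall y, A y -> exists a, ~ Q (s a) y].

Lemma open_set_typeP (A : set T) (U : set A) :
  open U <-> exists2 W : set T, open W & set_val @^-1` W = U.
Proof. by []. Qed.

Lemma covering_dim_le_indexed (A : set T) n :
  covering_dim_le A n -> indexed_dim_le A n.
Proof.
move=> dA k O Oo Oc.
have [|D [[Df Do Dc] DC Dn]] := dA (range (fun j => set_val @^-1` O j)).
  split=> [|_ [j _ <-]|y].
  - by apply: finite_image; exact: finite_finset.
  - by apply/open_set_typeP; exists (O j).
  - by have [j Oy] := Oc (\val y) (set_valP y); exists (set_val @^-1` O j) => //; exists j.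
(* Without repetitions, distinct indices give distinct members of [D], as the count of indices
   requires. *)
have /finite_seqP[s0 Ds0] := Df; pose s := undup s0.
have sD V : V \in s -> D V by rewrite mem_undup Ds0.
have snth (j : 'I_(size s)) : D (nth set0 s j) by apply/sD/mem_nth.
have /choice[Q QP] : forall j : 'I_(size s), exists W,
    open W /\ set_val @^-1` W = nth set0 s j.
  by move=> j; have /open_set_typeP[W oW WE] := Do _ (snth j); exists W.
exists (size s), Q; split=> [j|y Ay|j|t tI y Ay].
- by have [] := QP j.
- have [V DV Vy] := Dc (exist _ y (mem_set Ay)).
  have Vs : V \in s by move: DV; rewrite mem_undup Ds0.
  have jP : (index V s < size s)%N by rewrite index_mem.
  exists (Ordinal jP); have [_ QV] := QP (Ordinal jP).
  have : (set_val @^-1` Q (Ordinal jP)) (exist _ y (mem_set Ay)).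
    by rewrite QV /= nth_index.
  by [].
- have [_ [l _ <-] Vl] := DC _ (snth j).
  exists l => y Ay Qy; apply: (Vl (exist _ y (mem_set Ay))).
  by have [_ <-] := QP j.
apply: contrapT => nex.
have Qy a : Q (t a) y by apply: contrapT => nQ; apply: nex; exists a.
pose B := [set V | D V /\ V (exist _ y (mem_set Ay))].
have Bf : finite_set B by apply: sub_finite_set Df => V [].
have := geq_card_fset_set (Dn (exist _ y (mem_set Ay))); rewrite -/B leqNgt => /negP; apply.
pose l := [seq nth set0 s (t a) | a <- enum 'I_n.+2].
have -> : n.+2 = size l by rewrite size_map size_enum_ord.
apply: uniq_leq_size => [|V /mapP[a _ ->]].
  rewrite map_inj_uniq ?enum_uniq// => a b /eqP.
  by rewrite nth_uniq ?undup_uniq// => /eqP/val_inj/tI.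
rewrite in_fset_set//; apply/mem_set; split; first exact: snth.
by have [_ <-] := QP (t a); exact: Qy.
Qed.

Lemma indexed_covering_dim_le (A : set T) n :
  indexed_dim_le A n -> covering_dim_le A n.
Proof.
move=> dA C [/finite_seqP[s Cs] Co Cc].
have snth (j : 'I_(size s)) : C (nth set0 s j) by rewrite Cs /= mem_nth.
have /choice[U UP] : forall j : 'I_(size s), exists W,
    open W /\ set_val @^-1` W = nth set0 s j.
  by move=> j; have /open_set_typeP[W oW WE] := Co _ (snth j); exists W.
have [||k [Q [Qo Qc QO Qn]]] := dA _ U.
- by move=> j; have [] := UP j.
- move=> y Ay; have [V CV Vy] := Cc (exist _ y (mem_set Ay)).
  have Vs : V \in s by move: CV; rewrite Cs.
  have jP : (index V s < size s)%N by rewrite index_mem.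
  exists (Ordinal jP); have [_ UV] := UP (Ordinal jP).
  have : (set_val @^-1` U (Ordinal jP)) (exist _ y (mem_set Ay)).
    by rewrite UV /= nth_index.
  by [].
pose D := range (fun j => set_val @^-1` Q j : set A).
have Df : finite_set D by apply: finite_image; exact: finite_finset.
exists D; split=> [|_ [j _ <-]|y].
- split=> // [_ [j _ <-]|y]; first by apply/open_set_typeP; exists (Q j).
  by have [j Qy] := Qc (\val y) (set_valP y); exists (set_val @^-1` Q j) => //; exists j.
- have [l Ql] := QO j; exists (nth set0 s l); first exact: snth.
  by have [_ <-] := UP l; move=> z Qz; apply: Ql => //; exact: set_valP.
pose B := [set V | D V /\ V y].
have Bf : finite_set B by apply: sub_finite_set Df => V [].
have /finite_setP[m Bm] := Bf.
rewrite -/B (card_le_eql Bm) card_le_II leqNgt; apply/negP => nm.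
pose l := finmap.enum_fset (fset_set B).
have lm : size l = m by exact: card_fset_set.
(* One index is chosen per member, so [n + 2] distinct members at a point would give [n + 2]
   distinct indices there. *)
have /choice[f fP] : forall V, exists j, D V -> set_val @^-1` Q j = V.
  move=> V; have [[j _ VE]|nD] := pselect (D V); first by exists j.
  by have [j _] := Qc (\val y) (set_valP y); exists j => /nD.
have lB (a : 'I_n.+2) : B (nth set0 l a).
  apply/set_mem; rewrite -in_fset_set//; apply: mem_nth.
  by rewrite lm (leq_trans _ nm).
have [|a] := Qn (fun a => f (nth set0 l a)) _ (\val y) (set_valP y).
  move=> a b fab; apply/val_inj/eqP => /=.
  rewrite -(@nth_uniq _ set0 l) ?finmap.fset_uniq ?lm ?(leq_trans _ nm)//.
  by rewrite -(fP _ (lB a).1) fab fP//; have [] := lB b.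
apply; have [Da Va] := lB a.
have : (set_val @^-1` Q (f (nth set0 l a))) y by rewrite fP.
by [].
Qed.

End CoveringDimension.

(** * Vectors in general position *)

Section GeneralPosition.
Context {R : realType}.

(** The [size p] distinct numbers [a], [a + 1], and so on cannot all be roots. *)
Lemma poly_nonroot_ge (p : {poly R}) (a : R) : p != 0 ->
  exists2 t, a <= t & p.[t] != 0.
Proof.
move=> p0; apply: contrapT => nt.
pose l := [seq a + m%:R | m <- iota 0 (size p)].
suff : (size l < size p)%N by rewrite size_map size_iota ltnn.
apply: max_poly_roots => //.
  apply/allP => _ /mapP[m _ ->]; apply/rootP/eqP/negPn/negP => pm.
  by apply: nt; exists (a + m%:R) => //; rewrite lerDl.
rewrite map_inj_uniq ?iota_uniq// => m m' /addrI/eqP.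
by rewrite eqr_nat => /eqP.
Qed.

(* The perturbation is along the moment curve: with [v j = (1, j, j^2, ..)] and
   [p = q + t^-1 v], the determinant [det (v + t q) = t^m det p] is a polynomial
   in [t] whose value at [0] is a nonzero Vandermonde determinant. *)
Lemma general_position m k (q : 'I_k -> 'I_m -> R) (e : R) : 0 < e ->
  exists p : 'I_k -> 'I_m -> R,
    (forall j l, `|p j l - q j l| <= e) /\
    forall s : 'I_m -> 'I_k, injective s ->
      \det (\matrix_(a, l) p (s a) l) != 0.
Proof.
move=> e0.
pose v (j : 'I_k) (l : 'I_m) : R := j%:R ^+ l.
pose M (s : 'I_m -> 'I_k) : 'M[{poly R}]_m :=
  \matrix_(a, l) ((v (s a) l)%:P + q (s a) l *: 'X).
have ME s t : (\det (M s)).[t] = \det (\matrix_(a, l) (v (s a) l + q (s a) l * t)).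
  rewrite -[LHS]/(horner_eval t (\det (M s))) -det_map_mx; congr (\det _).
  by apply/matrixP => a l; rewrite !mxE -[LHS]/(horner _ t) !hornerE.
have M0 s : injective s -> \det (M s) != 0.
  move=> sI; apply: contraTneq isT => Ms0.
  have := ME s 0; rewrite Ms0 horner0.
  rewrite (_ : \matrix_(a, l) _ = (Vandermonde m (\row_a (s a)%:R))^T); last first.
    by apply/matrixP => a l; rewrite !mxE mulr0 addr0.
  rewrite det_tr det_Vandermonde => /esym/eqP; apply: contraLR => _.
  apply/prodf_neq0 => a _; apply/prodf_neq0 => b ab; rewrite !mxE subr_eq0 eqr_nat.
  by apply: contraTneq ab => /val_inj/sI ->; rewrite ltnn.
(* A nonroot of the product serves all injections at once; taking it at least [B / e] makes the
   perturbation at most [e]. *)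
pose P := \prod_(s : {ffun 'I_m -> 'I_k} | injectiveb s) \det (M s).
have P0 : P != 0 by apply/prodf_neq0 => s /injectiveP; exact: M0.
pose B := \sum_j \sum_l `|v j l|.
have vB j l : `|v j l| <= B.
  rewrite /B (bigD1 j)//= (bigD1 l)//= -addrA lerDl addr_ge0// sumr_ge0// => j' _.
  exact: sumr_ge0.
have [t Bt Pt] := poly_nonroot_ge (Num.max 1 (B / e)) P0.
have t0 : 0 < t by apply: lt_le_trans Bt; rewrite lt_max ltr01.
have {}Bt : B / e <= t by apply: le_trans Bt; rewrite le_max lexx orbT.
exists (fun j l => q j l + t^-1 * v j l); split=> [j l|s sI].
  rewrite addrC addKr normrM gtr0_norm ?invr_gt0// mulrC ler_pdivrMr//.
  by apply: le_trans (vB j l) _; rewrite mulrC -ler_pdivrMr.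
rewrite (_ : \matrix_(a, l) _ =
    t^-1 *: \matrix_(a, l) (v (s a) l + q (s a) l * t)); last first.
  by apply/matrixP => a l; rewrite !mxE; field; rewrite gt_eqF.
rewrite detZ mulf_neq0 ?expf_neq0 ?invr_neq0 ?(gt_eqF t0)// -ME.
move: Pt; rewrite /P horner_prod => /prodf_neq0/(_ (finfun s)).
have -> : M (finfun s) = M s by apply/matrixP => a l; rewrite !mxE ffunE.
by apply; apply/injectiveP => a b; rewrite !ffunE => /sI.
Qed.

(** At most [m] coefficients are nonzero. Their indices are completed to [m] distinct ones, possible
    as [m <= k], and the corresponding rows are linearly independent. *)
Lemma independent_comb m k (p : 'I_k -> 'I_m -> R) (a : 'I_k -> R) :
  (m <= k)%N ->
  (forall s : 'I_m -> 'I_k, injective s -> \det (\matrix_(b, l) p (s b) l) != 0) ->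
  (forall s : 'I_m.+1 -> 'I_k, injective s -> exists b, a (s b) = 0) ->
  (forall l, \sum_j a j * p j l = 0) -> forall j, a j = 0.
Proof.
move=> mk pdet am ap j0.
pose J := [pred j | a j != 0].
have Jm : (#|J| <= m)%N.
  rewrite leqNgt; apply/negP => mJ.
  have [|b ab] := am (fun b => nth j0 (enum J) b) _.
    move=> b c /eqP; rewrite nth_uniq ?enum_uniq// -?cardE ?(leq_trans _ mJ)//.
    by move=> /eqP/val_inj.
  have : nth j0 (enum J) b \in J.
    by rewrite -mem_enum mem_nth// -cardE (leq_trans _ mJ).
  by rewrite inE ab eqxx.
(* The support comes first, so the first [m] entries contain it. *)
pose l := enum J ++ enum [predC J].
have lk : size l = k by rewrite size_cat -!cardE cardC card_ord.
have lu : uniq l.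
  rewrite cat_uniq !enum_uniq andbT/=; apply/hasPn => j.
  by rewrite !mem_enum.
pose s (b : 'I_m) := nth j0 l b.
have sI : injective s.
  move=> b c /eqP; rewrite nth_uniq ?lk ?(leq_trans _ mk)// => /eqP; exact: val_inj.
have Js j : j \notin codom s -> a j = 0.
  apply: contraNeq => aj; have jJ : j \in enum J by rewrite mem_enum.
  have jm : (index j l < m)%N.
    by rewrite index_cat jJ (leq_trans _ Jm)// cardE index_mem.
  apply/codomP; exists (Ordinal jm).
  by rewrite /s/= nth_index// mem_cat jJ.
have as0 : (\row_b a (s b)) *m (\matrix_(b, l') p (s b) l') = 0.
  apply/rowP => l'; rewrite !mxE -[RHS](ap l').
  rewrite [RHS](bigID (mem (codom s)))/= [X in _ = _ + X]big1 ?addr0; last first.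
    by move=> j /Js ->; rewrite mul0r.
  rewrite -big_uniq/=; last by rewrite map_inj_uniq ?enum_uniq.
  rewrite codomE big_map big_enum/=.
  by apply: eq_bigr => b _; rewrite !mxE.
have sU : \matrix_(b, l') p (s b) l' \in unitmx.
  by rewrite unitmxE unitfE pdet.
have {}as0 : \row_b a (s b) = 0 by rewrite -(mulmxK sU (\row_b _)) as0 mul0mx.
have [/codomP[b ->]|/Js//] := boolP (j0 \in codom s).
by have := congr1 (fun u : 'rV_m => u ord0 b) as0; rewrite !mxE.
Qed.

(** To remove the condition [m <= k], the family is padded by [m] further vectors whose coefficients
    are 0. *)
Lemma generic_perturbation m k (q : 'I_k -> 'I_m -> R) (e : R) : 0 < e ->
  exists p : 'I_k -> 'I_m -> R,
    (forall j l, `|p j l - q j l| <= e) /\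
    forall a : 'I_k -> R,
      (forall s : 'I_m.+1 -> 'I_k, injective s -> exists b, a (s b) = 0) ->
      (forall l, \sum_j a j * p j l = 0) -> forall j, a j = 0.
Proof.
move=> e0.
pose pad T (d : T) (f : 'I_k -> T) (j : 'I_(k + m)) :=
  if fintype.split j is inl j' then f j' else d.
have padl T (d : T) f j : pad T d f (lshift m j) = f j.
  by rewrite /pad (unsplitK (inl j)).
have padr T (d : T) f j : pad T d f (rshift k j) = d.
  by rewrite /pad (unsplitK (inr j)).
have [p [pq pdet]] := general_position (pad _ (fun=> 0) q) e0.
exists (fun j => p (lshift m j)); split=> [j l|a am ap j].
  by have := pq (lshift m j) l; rewrite padl.
rewrite -(padl _ 0 a); apply: (independent_comb (p := p)) => [|//|s sI|l].
- exact: leq_addl.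
- apply: contrapT => ns.
  have s0 b : pad _ 0 a (s b) != 0 by apply/eqP => sb; apply: ns; exists b.
  have /choice[t tP] : forall b, exists j, s b = lshift m j.
    move=> b; have := s0 b; rewrite /pad; case: splitP => [j' sj _|]; last by rewrite eqxx.
    by exists j'; apply: val_inj.
  have [|b tb] := am t; first by move=> b c tbc; apply: sI; rewrite !tP tbc.
  by have := s0 b; rewrite tP padl tb eqxx.
- rewrite big_split_ord/= [X in _ + X]big1 ?addr0.
    by rewrite -[RHS](ap l); apply: eq_bigr => j' _; rewrite padl.
  by move=> j' _; rewrite padr mul0r.
Qed.

End GeneralPosition.

(** * Passage between functions on the space and on its compactification *)

Section HigsonExtension.
Context {R : realType} {X : metricType R} (x0 : X).
Context {K : topologicalType} (i : X -> K).
Context (hL : is_higson_sublinear_compactification x0 i).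

Lemma compactification_restrict (f : K -> R) : continuous f ->
  higson_sublinear x0 (f \o i) /\ exists B, forall x, `|f (i x)| <= B.
Proof.
move=> fc; have [[Kc _ [_ ic _] _] hf] := hL.
have [B fB] : exists B, forall z, `|f z| <= B.
  have : compact (f @` [set: K]).
    by apply: continuous_compact => //; exact: continuous_subspaceT.
  move=> /compact_bounded/pinfty_ex_gt0[B _ fB].
  by exists B => z; apply: fB; exists z.
split; last by exists B => x; exact: fB.
apply/hf; last by exists f.
- by move=> x; apply: continuous_comp; [exact: ic|exact: fc].
- exists B; split; first exact: num_real.
  by move=> M BM x _; apply: le_trans (fB _) (ltW BM).
Qed.

Lemma compactification_extend (F : X -> R) : is_lipschitz F ->
  exists2 g : K -> R, continuous g & forall x, g (i x) = F x / (1 + mdist x x0).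
Proof.
move=> /(is_lipschitz_quotient x0) [uc [B uB] us]; have [_ hf] := hL.
apply/(hf _ uc _) => //.
exists B; split; first exact: num_real.
by move=> M BM x _; apply: le_trans (uB _) (ltW BM).
Qed.

End HigsonExtension.

(** * From the extensor property to the dimension of the corona *)

Section ExtensorDimension.
Context {R : realType} {X : metricType R} (x0 : X).
Context {K : topologicalType} (i : X -> K).
Context (Xproper : proper_metric X).
Context (hL : is_higson_sublinear_compactification x0 i).

Let icomp : is_compactification i. Proof. by case: hL. Qed.

(** A partition of unity subordinate to the cover is turned into Lipschitz functions [G j]; these
    are shrunk to order [n + 1], and the positivity sets of the normalised results refine the
    cover. *)
Lemma extensor_dim_corona n :
  lipschitz_extensor x0 n.+1 -> indexed_dim_le (corona i) n.
Proof.
move=> LE k U Uo Uc.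
have [[y0 y0i]|ne] := pselect (exists y, corona i y); last first.
  exists 0%N, (fun=> set0); split=> [[]//|y yi|[]//|s _ y yi]; last first.
    by case: ne; exists y.
  by case: ne; exists y.
have [j0 _] := Uc _ y0i.
have [phi [phic phi0 phiU phi1]] := partition_of_unity x0 Xproper icomp Uo Uc.
have N1 x : 1 <= 1 + mdist x x0 by rewrite lerDl mdist_ge0.
have N0 x : 0 < 1 + mdist x x0 by exact: lt_le_trans (N1 x).
have k0 : 0 < k%:R :> R by rewrite ltr0n; apply: leq_ltn_trans (ltn_ord j0).
(* At each corona point some [phi j] is at least [1 / k], which is [4 * e]. *)
pose e : R := (4 * k%:R)^-1.
have e0 : 0 < e by rewrite invr_gt0 mulr_gt0.
have phie y : corona i y -> exists j, 3 * e < phi j y.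
  move=> yi; apply: contrapT => nj.
  have : \sum_j phi j y <= \sum_(j < k) 3 * e.
    by apply: ler_sum => j _; rewrite leNgt; apply/negP => h; apply: nj; exists j.
  rewrite phi1// sumr_const card_ord (_ : _ *+ k = 3 / 4); first lra.
  by rewrite -[LHS]mulr_natr /e; field; rewrite gt_eqF.
have [r rphi] : exists r, forall x, r <= mdist x x0 -> exists j, 3 * e < phi j (i x).
  apply: (far_near_corona x0 icomp (P := fun z => exists j, 3 * e < phi j z)) => y yi.
  have [j yj] := phie y yi.
  by apply: filterS (cvgr_gt (phi j y) (phic j y) _ yj) => z zj; exists j.
have /choice[W WP] : forall j, exists w, is_lipschitz w /\ exists C, forall x,
    `|w x - phi j (i x) * (1 + mdist x x0)| <= e * mdist x x0 + C.
  move=> j; have [ps [B pB]] := compactification_restrict hL (phic j).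
  by have [w wL wC] := lipschitz_approximation pB ps e0; exists w.
have /choice[C WC] := fun j => (WP j).2.
pose C' := \sum_j `|C j|.
have CC' j : C j <= C'.
  apply: le_trans (ler_norm _) _; rewrite /C' (bigD1 j)//= lerDl.
  exact: sumr_ge0.
have C'0 : 0 <= C' by apply: sumr_ge0.
(* Subtracting the error of the approximation puts [G j] below [phi j * (1 + |x|)] up to a constant;
   the margin [3 * e] leaves enough for growth. *)
pose G j x := Num.max 0 (W j x - e * (1 + mdist x x0)).
have GL j : is_lipschitz (G j).
  apply: is_lipschitz_max; first exact: is_lipschitz_cst.
  apply: is_lipschitzB; first by have [] := WP j.
  apply/is_lipschitzZ/is_lipschitzD; first exact: is_lipschitz_cst.
  exact: is_lipschitz_dist.
have G0 j x : 0 <= G j x by rewrite le_max lexx.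
have Gphi j x : G j x <= phi j (i x) * (1 + mdist x x0) + C'.
  rewrite ge_max addr_ge0 ?mulr_ge0 ?(ltW (N0 x))//=.
  have := WC j x; rewrite ler_norml => /andP[_]; have := CC' j; lra.
have Gg : grows_on x0 [set: X] G.
  exists e => //; exists (C' + e * `|r|) => x _.
  have er : 0 <= e * `|r| by rewrite mulr_ge0// ltW.
  have [rx|xr] := leP r (mdist x x0).
    have [j xj] := rphi x rx; exists j; rewrite le_max; apply/orP; right.
    have := WC j x; rewrite ler_norml => /andP[+ _]; have := CC' j.
    have := ler_wpM2r (ltW (N0 x)) (ltW xj); lra.
  exists j0; apply: le_trans (G0 _ _).
  have : e * mdist x x0 <= e * `|r|.
    by rewrite ler_wpM2l ?(ltW e0)// (le_trans (ltW xr))// ler_norm.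
  lra.
have [H [HL HG [c c0 [b Hb]] Hs]] := shrink_order LE GL G0 Gg.
have H0 j x : 0 <= H j x by have /andP[] := HG j x.
have /choice[h hP] : forall j, exists g, continuous g /\
    forall x, g (i x) = H j x / (1 + mdist x x0).
  by move=> j; have [g gc gH] := compactification_extend hL (HL j); exists g.
have hc j : continuous (h j) by have [] := hP j.
have hE j x : h j (i x) = H j x / (1 + mdist x x0) by have [] := hP j.
exists k, (fun j => [set z | 0 < h j z]); split=> [j|y yi|j|s sI y yi].
- rewrite (_ : [set z | _] = h j @^-1` [set a | 0 < a])//.
  by apply: open_comp => [z _|]; [exact: hc|exact: open_gt].
- apply: contrapT => ny.
  have hle j : h j y <= 0 by rewrite leNgt; apply/negP => hj; apply: ny; exists j.
  have : \forall z \near y, forall j, h j z < c / 2.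
    apply: filter_forall => j; apply: (cvgr_lt (h j y) (hc j y)).
    by apply: le_lt_trans (hle j) _; lra.
  (* Beyond this radius [c * |x| - b] is at least [c / 2 * (1 + |x|)], so some [h j] is at least
     [c / 2]. *)
  move=> /(near_corona_far x0 Xproper icomp (2 * `|b| / c + 1) yi)[x rx hx].
  have [j Hj] := Hb x I; have := hx j; rewrite hE ltr_pdivrMr//.
  have : 2 * `|b| + c <= c * mdist x x0.
    have := ler_wpM2l (ltW c0) (ltW rx); congr (_ <= _).
    by field; rewrite gt_eqF.
  have := ler_norm b; lra.
- exists j => y yi /= hj; apply: phiU.
  (* The slack [h j y / 2] absorbs the bounded error [C'] at far points, where it is divided by
     [1 + |x|]; this yields [0 < phi j y]. *)
  have : 0 <= phi j y + h j y / 2 - h j y.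
    apply: (corona_ge0 (x0 := x0) Xproper icomp
      (f := fun z => phi j z + h j y / 2 - h j z) (r := 2 * C' / h j y)) => //.
      move=> z; apply: cvgB; last exact: hc.
      by apply: cvgD; [exact: phic|exact: cvg_cst].
    move=> x rx; rewrite hE subr_ge0 ler_pdivrMr//.
    have /andP[_ HGx] := HG j x; apply: le_trans HGx _; apply: le_trans (Gphi j x) _.
    rewrite ler_pdivrMr// in rx; rewrite mulrDl lerD2l; lra.
  lra.
apply: contrapT => ns.
have hpos a : 0 < h (s a) y by apply: contrapT => nh; apply: ns; exists a.
(* Common positivity is an open condition, so it would reach a point of [X], where one of the
   functions vanishes. *)
have : \forall z \near y, forall a, 0 < h (s a) z.
  by apply: filter_forall => a; exact: (cvgr_gt (h (s a) y) (hc _ y)).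
move=> /(near_corona_far x0 Xproper icomp 0 yi)[x _ hx].
have [a Ha] := Hs s sI x.
by have := hx a; rewrite hE Ha mul0r ltxx.
Qed.

End ExtensorDimension.

Lemma sumr_const_ord (R : realType) n (a : R) : \sum_(l < n) a = n%:R * a.
Proof. by rewrite sumr_const card_ord -[LHS]mulr_natl. Qed.

(** Here [g] is the point of the interval from [f - t] to [f + t] nearest to [w]. *)
Lemma clampP (R : realType) (f t w : R) : 0 <= t ->
  let g := Num.max (f - t) (Num.min (f + t) w) in
  [/\ `|g - f| <= t, `|g - f| <= `|w - f| & `|g - w| <= Num.max 0 (`|w - f| - t)].
Proof.
move=> t0 g; rewrite le_max /g.
have n1 := ler_norm (w - f); have n2 := ler_norm (- (w - f)); rewrite normrN in n2.
have [h1|h1] := leP (f + t) w; have [h2|h2] := leP (f - t) _; split;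
  rewrite !ler_norml; try (by apply/andP; split; lra).
all: apply/orP; try (by left; apply/andP; split; lra).
all: right; apply/andP; split; lra.
Qed.

(** * From the dimension of the corona to the extensor property *)

Section DimensionExtensor.
Context {R : realType} {X : metricType R} (x0 : X).
Context {K : topologicalType} (i : X -> K).
Context (Xproper : proper_metric X).
Context (hL : is_higson_sublinear_compactification x0 i).

Let icomp : is_compactification i. Proof. by case: hL. Qed.

(** A cover by sets of small oscillation of [u] is refined to order [n + 1]. At each corona point at
    most [n + 1] of the [phi j] are nonzero, so with generic values [p j] a vanishing combination
    would force all [phi j] to vanish, although they sum to 1. *)
Lemma corona_nonvanishing_approximation n (u : 'I_n.+1 -> K -> R) (e : R) :
  indexed_dim_le (corona i) n -> 0 < e -> (forall l, continuous (u l)) ->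
  exists v : 'I_n.+1 -> K -> R,
    [/\ forall l, continuous (v l),
        forall y, corona i y -> forall l, `|v l y - u l y| <= e &
        forall y, corona i y -> 0 < \sum_l `|v l y|].
Proof.
move=> dn e0 uc.
have e20 : 0 < e / 2 by lra.
pose f y := interior [set z | forall l, `|u l z - u l y| < e / 2].
have [|s si sc] := @compact_finite_subcover K _ f (corona_compact x0 Xproper icomp).
  move=> y yi; apply: nbhs_interior; apply: filter_forall => l.
  have /cvgrPdist_lt/(_ _ e20) := uc l y.
  by apply: filterS => z; rewrite distrC.
pose c j := nth (i x0) s j.
have [|y yi|k [Q [Qo Qc Qf Qn]]] := dn _ (fun j : 'I_(size s) => f (c j)).
- by move=> j; exact: open_interior.
- have [z zs zy] := sc y yi.
  have jP : (index z s < size s)%N by rewrite index_mem.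
  by exists (Ordinal jP); rewrite /c /= nth_index.
have /choice[t tQ] := Qf.
have [phi [phic phi0 phiQ phi1]] := partition_of_unity x0 Xproper icomp Qo Qc.
have [p [pq pgen]] := generic_perturbation (fun j l => u l (c (t j))) e20.
exists (fun l z => \sum_j phi j z * p j l); split=> [l|y yi l|y yi].
- apply: continuous_sumr => j z; apply: cvgM; [exact: phic|exact: cvg_cst].
- rewrite -[u l y]mul1r -(phi1 y yi) mulr_suml -sumrB.
  apply: le_trans (ler_norm_sum _ _ _) _.
  rewrite -[leRHS]mul1r -(phi1 y yi) mulr_suml; apply: ler_sum => j _.
  rewrite -mulrBr normrM ger0_norm//.
  have := phi0 j y; rewrite le_eqVlt => /predU1P[<-|phij]; first by rewrite !mul0r.
  rewrite ler_pM2l//.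
  have /interior_subset/(_ l) := tQ j y yi (phiQ _ _ phij).
  have := pq j l; have := ler_distD (u l (c (t j))) (p j l) (u l y).
  by rewrite (distrC (u l y)); lra.
rewrite lt_neqAle sumr_ge0// andbT eq_sym; apply/eqP => v0.
have phiz : forall j, phi j y = 0.
  apply: pgen => [r rI|l]; last first.
    apply/eqP; rewrite -normr_le0 -[leRHS]v0 [leRHS](bigD1 l)//= lerDl.
    exact: sumr_ge0.
  have [a nQ] := Qn r rI y yi; exists a; apply/eqP.
  by rewrite eq_le phi0 andbT leNgt; apply/negP => /phiQ.
have := phi1 y yi; rewrite big1// => /eqP.
by rewrite eq_sym oner_eq0.
Qed.

(** The normalised [F] is approximated on the corona by a nowhere vanishing [v], and [v * (1 + |x|)]
    is approximated by Lipschitz functions. *)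
Lemma nonvanishing_lipschitz_approximation n (F : 'I_n.+1 -> X -> R) (e : R) :
  indexed_dim_le (corona i) n -> 0 < e -> (forall l, is_lipschitz (F l)) ->
  exists W : 'I_n.+1 -> X -> R,
    [/\ forall l, is_lipschitz (W l),
        exists C, forall l x, `|W l x - F l x| <= e * mdist x x0 + C &
        exists2 a, 0 < a & exists b, forall x, a * mdist x x0 - b <= \sum_l `|W l x|].
Proof.
move=> dn e0 FL.
have N1 x : 1 <= 1 + mdist x x0 by rewrite lerDl mdist_ge0.
have N0 x : 0 < 1 + mdist x x0 by exact: lt_le_trans (N1 x).
have /choice[u uP] : forall l, exists g, continuous g /\
    forall x, g (i x) = F l x / (1 + mdist x x0).
  by move=> l; have [g gc gF] := compactification_extend hL (FL l); exists g.
have uc l : continuous (u l) by have [] := uP l.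
have uF l x : u l (i x) * (1 + mdist x x0) = F l x.
  by have [_ ->] := uP l; rewrite divfK// gt_eqF.
have e40 : 0 < e / 4 by lra.
have [v [vc vu v0]] := corona_nonvanishing_approximation dn e40 uc.
have [|eta eta0 [r rv]] := far_pos_bound x0 Xproper icomp (f := fun z => \sum_l `|v l z|) _ v0.
  by apply: continuous_sumr => l z; apply: cvg_norm; exact: vc.
have [r' rvu] : exists r', forall x, r' <= mdist x x0 ->
    forall l, `|v l (i x) - u l (i x)| < e / 2.
  apply: (far_near_corona x0 icomp (P := fun z => forall l, `|v l z - u l z| < e / 2)) => y yi.
  apply: filter_forall => l.
  have vuc : {for y, continuous (fun z => `|v l z - u l z|)}.
    by apply: cvg_norm; apply: cvgB; [exact: vc|exact: uc].
  apply: (cvgr_lt _ vuc); have := vu y yi l; lra.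
pose m : R := n.+1%:R; have m0 : 0 < m by rewrite ltr0n.
(* The first bound adds to the error [e / 2] of [v]; the second keeps the total error of the [m]
   coordinates below half of the lower bound [eta]. *)
pose d := Num.min (e / 4) (eta / (2 * m)).
have d0 : 0 < d by rewrite lt_min e40/= divr_gt0// mulr_gt0.
have de : d <= e / 4 by rewrite ge_min lexx.
have deta : m * d <= eta / 2.
  rewrite mulrC -ler_pdivlMr//; apply: (@le_trans _ _ (eta / (2 * m))).
    by rewrite ge_min lexx orbT.
  by rewrite invfM mulrA.
have /choice[W WP] : forall l, exists w, is_lipschitz w /\ exists C, forall x,
    `|w x - v l (i x) * (1 + mdist x x0)| <= d * mdist x x0 + C.
  move=> l; have [ps [B pB]] := compactification_restrict hL (vc l).
  by have [w wL wC] := lipschitz_approximation pB ps d0; exists w.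
have WL l : is_lipschitz (W l) by have [] := WP l.
have /choice[C WC] := fun l => (WP l).2.
pose D := \sum_l `|C l|.
have CD l : C l <= D.
  apply: le_trans (ler_norm _) _; rewrite /D (bigD1 l)//= lerDl.
  exact: sumr_ge0.
have D0 : 0 <= D by apply: sumr_ge0.
exists W; split=> //.
  have /choice[B BP] : forall l, exists B, 0 < B /\
      forall x, `|W l x - F l x| <= B * (1 + mdist x x0).
    move=> l; have [B B0 BW] := is_lipschitz_linear_growth x0 (is_lipschitzB (WL l) (FL l)).
    by exists B.
  pose B' := \sum_l B l.
  have BB l : B l <= B'.
    by rewrite /B' (bigD1 l)//= lerDl sumr_ge0// => j _; have [/ltW] := BP j.
  have B'0 : 0 <= B' by apply: sumr_ge0 => l _; have [/ltW] := BP l.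
  (* The last term covers the ball of radius [r'], where only linear growth of [W - F] is
     available. *)
  exists (D + e / 2 + B' * (1 + `|r'|)) => l x.
  have d'0 := mdist_ge0 x x0.
  have B'r : 0 <= B' * (1 + `|r'|) by rewrite mulr_ge0// addr_ge0.
  have ex : 0 <= e * mdist x x0 by rewrite mulr_ge0// ltW.
  have [rx|xr] := leP r' (mdist x x0).
    have h1 := ler_wpM2r (ltW (N0 x)) (ltW (rvu x rx l)).
    rewrite -[X in _ * X <= _](gtr0_norm (N0 x)) -normrM mulrBl uF in h1.
    have h2 := ler_distD (v l (i x) * (1 + mdist x x0)) (W l x) (F l x).
    have h3 := WC l x; have h4 := CD l.
    have h5 : d * mdist x x0 <= e / 4 * mdist x x0 by rewrite ler_wpM2r.
    lra.
  have [_ /(_ x) h1] := BP l.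
  have h2 : B l * (1 + mdist x x0) <= B' * (1 + `|r'|).
    apply: ler_pM => //; [by have [/ltW] := BP l|exact: ltW|].
    by rewrite lerD2l (le_trans (ltW xr))// ler_norm.
  lra.
exists (eta / 2); first lra.
exists (m * D + eta * `|r|) => x.
have d'0 := mdist_ge0 x x0.
have mD : 0 <= m * D by rewrite mulr_ge0// ltW.
have er : 0 <= eta * `|r| by rewrite mulr_ge0// ltW.
have [rx|xr] := leP r (mdist x x0); last first.
  apply: (@le_trans _ _ 0); last exact: sumr_ge0.
  have : eta * mdist x x0 <= eta * `|r|.
    by rewrite ler_wpM2l ?(ltW eta0)// (le_trans (ltW xr))// ler_norm.
  have : 0 <= eta * mdist x x0 by rewrite mulr_ge0// ltW.
  lra.
have h1 := ler_wpM2r (ltW (N0 x)) (rv x rx).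
have h2 : (\sum_l `|v l (i x)|) * (1 + mdist x x0) <=
    \sum_l `|W l x| + \sum_(l < n.+1) (d * mdist x x0 + D).
  rewrite mulr_suml -big_split/=; apply: ler_sum => l _.
  rewrite -[X in _ * X <= _](gtr0_norm (N0 x)) -normrM.
  have := lerB_dist (v l (i x) * (1 + mdist x x0)) (W l x).
  rewrite [X in _ <= X -> _]distrC; have := WC l x; have := CD l; lra.
rewrite sumr_const_ord -/m in h2.
have h3 : m * d * mdist x x0 <= eta / 2 * mdist x x0 by rewrite ler_wpM2r.
lra.
Qed.

(* Clamping [W] to the band of radius [max 0 (c |x| / 2 - sum |F l x|)] around
   [F] keeps [F] where it is large, and gives [W] where it is small. *)
Lemma dim_corona_extensor n :
  indexed_dim_le (corona i) n -> lipschitz_extensor x0 n.+1.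
Proof.
move=> dn A F cA FL [c c0 [b Fb]].
pose m : R := n.+1%:R; have m0 : 0 < m by rewrite ltr0n.
(* The errors of all [m] coordinates together amount to [c / 8 * |x|], up to a constant. *)
pose e := c / (8 * m); have e0 : 0 < e by rewrite divr_gt0// mulr_gt0.
have em : m * e = c / 8 by rewrite /e; field; rewrite gt_eqF.
have [W [WL [C WF] [a a0 [b' Wb]]]] :=
  nonvanishing_lipschitz_approximation dn e0 FL.
pose S x := \sum_l `|F l x|.
have S0 x : 0 <= S x by exact: sumr_ge0.
pose T x := Num.max 0 (c / 2 * mdist x x0 - S x).
have T0 x : 0 <= T x by rewrite le_max lexx.
have TL : is_lipschitz T.
  apply: is_lipschitz_max; first exact: is_lipschitz_cst.
  apply: is_lipschitzB; first exact/is_lipschitzZ/is_lipschitz_dist.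
  by apply: is_lipschitz_sum => l; exact: is_lipschitz_norm.
pose G l x := Num.max (F l x - T x) (Num.min (F l x + T x) (W l x)).
have GP l x := clampP (F l x) (W l x) (T0 x).
have GF l x : `|G l x - F l x| <= T x by have [] := GP l x.
have GWF l x : `|G l x - F l x| <= `|W l x - F l x| by have [] := GP l x.
have GW l x : `|G l x - W l x| <= Num.max 0 (`|W l x - F l x| - T x).
  by have [] := GP l x.
exists G, `|b|; split=> [l|l x Ax|].
- apply: is_lipschitz_max; first exact: is_lipschitzB.
  by apply: is_lipschitz_min => //; exact: is_lipschitzD.
(* On [A] the sum [S] is at least [c * |x| - b], so the clamping radius [T] is at most [|b|]. *)
- apply: le_trans (GF l x) _; rewrite ge_max normr_ge0/=.
  have [j Fj] := Fb x Ax.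
  have : `|F j x| <= S x by rewrite /S (bigD1 j)//= lerDl sumr_ge0.
  have : 0 <= c * mdist x x0 by rewrite mulr_ge0 ?mdist_ge0// ltW.
  have := ler_norm b; lra.
have [a' a'0 [b'' Gb]] : exists2 a', 0 < a' & exists b'', forall x,
    a' * mdist x x0 - b'' <= \sum_l `|G l x|.
  exists (Num.min a (c / 8)); first by rewrite lt_min a0; lra.
  exists (`|b'| + m * `|C|) => x.
  have d0 := mdist_ge0 x x0.
  have mC : 0 <= m * `|C| by rewrite mulr_ge0// ltW.
  have bn := ler_norm b'; have b0 := normr_ge0 b'.
  have CC := ler_norm C; have C0 := normr_ge0 C.
  have m1 : Num.min a (c / 8) * mdist x x0 <= a * mdist x x0.
    by rewrite ler_wpM2r// ge_min lexx.
  have m2 : Num.min a (c / 8) * mdist x x0 <= c / 8 * mdist x x0.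
    by rewrite ler_wpM2r// ge_min lexx orbT.
  (* If [F] is large, [G] loses at most [c / 8 * |x|] up to a constant. Otherwise [T] is at least
     [c / 4 * |x|], which exceeds the linear part of the distance from [W] to [F], so [G] stays
     within [|C|] of [W]. *)
  have [xS|Sx] := leP (c / 4 * mdist x x0) (S x).
    have : S x <= \sum_l `|G l x| + \sum_(l < n.+1) (e * mdist x x0 + `|C|).
      rewrite -big_split/=; apply: ler_sum => l _.
      have := lerB_dist (F l x) (G l x); rewrite [X in _ <= X -> _]distrC.
      have := GWF l x; have := WF l x; lra.
    have emx : m * e * mdist x x0 = c / 8 * mdist x x0 by rewrite em.
    rewrite sumr_const_ord -/m; lra.
  have : \sum_l `|W l x| <= \sum_l `|G l x| + \sum_(l < n.+1) `|C|.
    rewrite -big_split/=; apply: ler_sum => l _.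
    have := lerB_dist (W l x) (G l x); rewrite [X in _ <= X -> _]distrC.
    have h1 : T x >= c / 4 * mdist x x0 by rewrite le_max; apply/orP; right; lra.
    have h2 : e <= c / 8.
      rewrite -em ler_peMl ?(ltW e0)// ler1n//.
    have h3 := ler_wpM2r d0 h2.
    have h4 : Num.max 0 (`|W l x - F l x| - T x) <= `|C|.
      rewrite ge_max C0/=; have := WF l x; have : 0 <= c * mdist x x0 by rewrite mulr_ge0// ltW.
      lra.
    have := GW l x; lra.
  rewrite sumr_const_ord -/m.
  have := Wb x; lra.
exists (a' / m); first exact: divr_gt0.
exists (b'' / m) => x _; apply: contrapT => nj.
have : \sum_l `|G l x| < \sum_(l < n.+1) (a' / m * mdist x x0 - b'' / m).
  apply: ltr_sum; first by apply/hasP; exists ord0.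
  by move=> l _; rewrite ltNge; apply/negP => h; apply: nj; exists l.
rewrite sumr_const_ord -/m mulrBr.
rewrite (_ : m * (a' / m * mdist x x0) = a' * mdist x x0); last by field; rewrite gt_eqF.
rewrite (_ : m * (b'' / m) = b''); last by field; rewrite gt_eqF.
by have := Gb x; lra.
Qed.

End DimensionExtensor.

(* A set coerces to the type of its elements, with the subspace topology. For
   infinite dimension, the equivalence says that no R^(n+1) is an absolute
   extensor of X. *)
Theorem corollary6p2 (R : realType) (X : metricType R) (x0 : X)
    (K : topologicalType) (i : X -> K) :
  proper_metric X ->
  is_higson_sublinear_compactification x0 i ->
  forall n : nat,
    has_covering_dim (corona i) n <->
    is_least (fun m => euclidean_absolute_extensor x0 m.+1) n.
Proof.
move=> Xproper hL n.
have dimE m : covering_dim_le (corona i) m <-> euclidean_absolute_extensor x0 m.+1.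
  split=> [/covering_dim_le_indexed/(dim_corona_extensor Xproper hL)|].
    exact: lipschitz_extensor_euclidean.
  move=> /euclidean_extensor_lipschitz/(extensor_dim_corona Xproper hL).
  exact: indexed_covering_dim_le.
by split=> -[dn nmin]; split=> [|m dm]; [exact/dimE|exact/nmin/dimE|exact/dimE|exact/nmin/dimE].
Qed.
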